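(* Let $(u_p,v_p,g_p,h_p)(\theta,Y)$ be a sufficiently regular solution, $2\pi$-periodic in $\theta$, on $\mathbb T\times(-\infty,0]$, of the steady MHD--Prandtl problem $$u_p\partial_\theta u_p+v_p\partial_Yu_p-g_p\partial_\theta g_p-h_p\partial_Yg_p-\kappa\partial_{YY}u_p=0,$$ $$\partial_\theta g_p+\partial_Y\Big(\frac{v_pg_p}{u_p}\Big)-\partial_Y\Big(\frac{\partial_Yg_p}{u_p}\Big)=0,\qquad \partial_\theta u_p+\partial_Yv_p=0,\qquad \partial_\theta g_p+\partial_Yh_p=0,$$ $$u_p|_{Y=0}=\alpha+\eta f(\theta),\qquad v_p|_{Y=0}=0,\qquad g_p|_{Y=0}=\beta+\eta\widehat f(\theta),\qquad \lim_{Y\to-\infty}(\partial_Yu_p,\partial_Yg_p)=(0,0).$$ Assume, after a possible reversal of orientation, that $$u_p\ge c_*>0,\qquad (u_p,g_p)\longrightarrow(a,b)\quad\text{as }Y\to-\infty,$$ where $a,b$ are constants, and assume the following polynomially weighted bounds for two derivatives and some weight $l>1$: $$\sum_{j+k\le2}\int_{-\infty}^0\int_0^{2\pi}\Big|\partial_\theta^j\partial_Y^k\big(u_p-a,\;v_p-v_\infty,\;g_p-b,\;h_p-h_\infty\big)\Big|^2\langle Y\rangle^{2l}\,d\theta\,dY\le C\eta^2 .$$ Then, in the von Mises coordinate $\psi=\int_0^Yu_p(\theta,z)\,dz$, $$\frac{d^2}{d\psi^2}\int_0^{2\pi}g_p\,d\theta=0,\qquad \frac{d^2}{d\psi^2}\int_0^{2\pi}(\kappa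 u_p^2-g_p^2)\,d\theta=0.$$ Both integrals are constant in $\psi$, and hence $$b=\beta,\qquad \kappa a^2-b^2=\frac1{2\pi}\int_0^{2\pi}\big[\kappa(\alpha+\eta f)^2-(\beta+\eta\widehat f)^2\big]\,d\theta.$$ Equivalently, $$a^2=\alpha^2+\frac{\eta^2}{2\pi}\int_0^{2\pi}\big(f^2-\kappa^{-1}\widehat f^{\,2}\big)\,d\theta,$$ and $a$ is determined by requiring it to have the same sign as $\alpha$.
   Context: $\mathbb T=\mathbb R/2\pi\mathbb Z$ and $\langle Y\rangle=(1+Y^2)^{1/2}$. Here $\kappa>0$ is fixed, $\alpha\neq0$ and $\beta$ are real constants, $0<\eta\ll1$ is a small parameter, and $f,\widehat f$ are smooth $2\pi$-periodic functions with zero mean over $[0,2\pi]$. The functions $v_\infty(\theta)=\lim_{Y\to-\infty}v_p(\theta,Y)$ and $h_\infty(\theta)=\lim_{Y\to-\infty}h_p(\theta,Y)$ are the far-field limits of the normal components, and $C$ is a constant. Reversal of orientation means replacing $(\theta,u_p,g_p)$ by $(-\theta,-u_p,-g_p)$, with the boundary data changed accordingly. In the identities involving $\psi$, the functions are regarded as functions of $(\theta,\psi)$, and the $\theta$-integrals are taken at fixed $\psi$.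
   Formalization: The formal theorem also assumes h_p = (v_p g_p − ∂_Y g_p)/u_p + e with e a real constant; the displayed equations only give e = e(θ), and for non-constant e the second identity and the formula for a can fail. *)

(* Defs.v *)
From Stdlib Require Import Reals.
From Coquelicot Require Import Coquelicot.
Open Scope R_scope.

(* Functions on T x (-oo,0] are functions (theta, Y) of two reals, 2 PI-periodic
   in theta; their values at Y > 0 never matter. *)

Definition d_theta (w : R -> R -> R) (theta Y : R) : R :=
  Derive (fun t => w t Y) theta.

Definition d_Y (w : R -> R -> R) (theta Y : R) : R :=
  Derive (fun z => w theta z) Y.

Definition periodic (f : R -> R) : Prop :=
  forall theta, f (theta + 2 * PI) = f theta.

Definition smooth (f : R -> R) : Prop :=
  forall n theta, ex_derive_n f n theta.

Definition zero_mean (f : R -> R) : Prop :=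
  RInt f 0 (2 * PI) = 0.

Definition C2_interior (w : R -> R -> R) : Prop :=
  forall theta Y, Y < 0 -> ex_diff_n w 2 theta Y.

(* Regularity of a classical solution: C^2 for Y < 0 and continuous up to the
   boundary Y = 0 (one-sided, by restriction to the closed half-plane). *)
Definition regular (w : R -> R -> R) : Prop :=
  C2_interior w /\
  continuous_on (fun p : R * R => snd p <= 0) (fun p => w (fst p) (snd p)).

(* uw and gw are the boundary data of u and g on Y = 0. *)
Definition MHD_Prandtl (kappa : R) (uw gw : R -> R) (u v g h : R -> R -> R) : Prop :=
  (forall theta Y, Y < 0 ->
     u theta Y * d_theta u theta Y + v theta Y * d_Y u theta Y
     - g theta Y * d_theta g theta Y - h theta Y * d_Y g theta Y
     - kappa * d_Y (d_Y u) theta Y = 0) /\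
  (forall theta Y, Y < 0 ->
     d_theta g theta Y
     + d_Y (fun t z => v t z * g t z / u t z) theta Y
     - d_Y (fun t z => d_Y g t z / u t z) theta Y = 0) /\
  (forall theta Y, Y < 0 -> d_theta u theta Y + d_Y v theta Y = 0) /\
  (forall theta Y, Y < 0 -> d_theta g theta Y + d_Y h theta Y = 0) /\
  (forall theta, u theta 0 = uw theta /\ v theta 0 = 0 /\ g theta 0 = gw theta) /\
  (forall theta, is_lim (fun Y => d_Y u theta Y) m_infty 0 /\
                 is_lim (fun Y => d_Y g theta Y) m_infty 0).

(* The second equation of the system is the divergence-free condition for (g, h)
   after the substitution h = (v g - d_Y g) / u, the integrated induction
   equation.  The system itself only says that h - (v g - d_Y g) / u does not
   depend on Y; here this remainder is also required not to depend on theta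
   (the substitution above is the case e = 0).  Otherwise h could be shifted by an
   arbitrary function of theta, which changes the momentum equation. *)
Definition induction_relation (u v g h : R -> R -> R) : Prop :=
  exists e : R, forall theta Y, Y < 0 ->
    h theta Y = (v theta Y * g theta Y - d_Y g theta Y) / u theta Y + e.

(* Reversal of orientation, performed when r = true: theta is replaced by - theta
   in every function, and u, g and their boundary data also change sign. *)
Definition reverse_odd (r : bool) (w : R -> R -> R) : R -> R -> R :=
  fun theta Y => if r then - w (- theta) Y else w theta Y.

Definition reverse_even (r : bool) (w : R -> R -> R) : R -> R -> R :=
  fun theta Y => if r then w (- theta) Y else w theta Y.

Definition reverse_data (r : bool) (f : R -> R) : R -> R :=
  fun theta => if r then - f (- theta) else f theta.

Definition reverse_const (r : bool) (c : R) : R :=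
  if r then - c else c.

Definition japanese (Y : R) : R := sqrt (1 + Y ^ 2).

Definition weighted_slice (l : R) (j k : nat) (w1 w2 w3 w4 : R -> R -> R) (Y : R) : R :=
  RInt (fun theta =>
          ((partial_derive j k w1 theta Y) ^ 2 + (partial_derive j k w2 theta Y) ^ 2
           + (partial_derive j k w3 theta Y) ^ 2 + (partial_derive j k w4 theta Y) ^ 2)
          * Rpower (japanese Y) (2 * l)) 0 (2 * PI).

Definition weighted_H2_bound (l M : R) (w1 w2 w3 w4 : R -> R -> R) : Prop :=
  C2_interior w1 /\ C2_interior w2 /\ C2_interior w3 /\ C2_interior w4 /\
  (forall j k : nat, (j + k <= 2)%nat ->
     ex_RInt_gen (weighted_slice l j k w1 w2 w3 w4)
       (Rbar_locally m_infty) (at_left 0)) /\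
  sum_f_R0 (fun j => sum_f_R0 (fun k =>
     RInt_gen (weighted_slice l j k w1 w2 w3 w4)
       (Rbar_locally m_infty) (at_left 0)) (2 - j)) 2 <= M.

Definition von_Mises (u : R -> R -> R) (theta Y : R) : R :=
  RInt (fun z => u theta z) 0 Y.

(* (theta, psi) |-> (theta, Yv theta psi) is the inverse of the change of variables
   (theta, Y) |-> (theta, psi) of T x (-oo,0] onto itself. *)
Definition von_Mises_inverse (u Yv : R -> R -> R) : Prop :=
  (forall theta Y, Y <= 0 ->
     von_Mises u theta Y <= 0 /\ Yv theta (von_Mises u theta Y) = Y) /\
  (forall theta psi, psi <= 0 ->
     Yv theta psi <= 0 /\ von_Mises u theta (Yv theta psi) = psi).

Definition theta_integral (w : R -> R -> R) (psi : R) : R :=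
  RInt (fun theta => w theta psi) 0 (2 * PI).

Definition theta_integrable (w : R -> R -> R) : Prop :=
  forall psi, psi <= 0 -> ex_RInt (fun theta => w theta psi) 0 (2 * PI).

Definition zero_second_derivative (A : R -> R) : Prop :=
  forall psi, psi < 0 -> ex_derive A psi /\ is_derive_n A 2 psi 0.

Definition constant_on_half_line (A : R -> R) : Prop :=
  forall psi1 psi2, psi1 <= 0 -> psi2 <= 0 -> A psi1 = A psi2.

(* Main.v *)
Require Import Defs.
From Stdlib Require Import Reals Lra Lia.
From Coquelicot Require Import Coquelicot.
Open Scope R_scope.

(** The proof rewrites the system along the streamlines.  Since [v] vanishes on the
    boundary and [(u, v)] is divergence free, [psi = von_Mises u] satisfies
    [psi_Y = u] and [psi_theta = - v] (von_Mises_dY, von_Mises_flux).  Hence a curve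
    [psi = const] is a graph [Y = Yv theta psi] with slope [v / u], the derivative at fixed
    [psi] is the material derivative [m(w) = w_theta + (v / u) w_Y], and [d/dpsi] is
    [(1 / u) d/dY].  Two facts drive everything: the derivative in [psi] of the
    [theta]-integral of [w] is the integral of [w_Y / u] (is_derive_theta_integral), and the
    integral of [m(w)] over a period vanishes (theta_integral_material).

    With the divergence-free condition, the induction equation becomes
    [(1 / u) d_Y (g_Y / u) = m (g / u)], so the integral of [g] has zero second
    derivative in [psi].  Substituting [h = (v g - g_Y) / u + e] in the momentum equation
    gives [(1 / u) d_Y (kappa u_Y - g g_Y / u) = m (u - g^2 / u) - e g_Y / u].
    The integral of the left-hand side is half the second derivative of the integral of
    [kappa u^2 - g^2]; the integral of the right-hand side is [- e] times the first
    derivative of the integral of [g], which is zero as soon as the latter integral is known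
    to be constant.  So the first conservation law (conserved_field) is an ingredient
    of the second one (conserved_momentum).

    An affine function on a half-line that has a limit at infinity is constant
    (limit_of_affine), so it remains to see that both integrals converge as
    [psi -> -oo].  This is where the weighted bound enters: the square integrability of
    [w = u - a] or [w = g - b] together with [w_theta], [w_Y], [w_(theta Y)] forces [w] to
    tend to zero uniformly in [theta] (uniform_decay), by the elementary
    one-dimensional Sobolev inequality (point_le_RInt) used once in [theta] and once in [Y].
    The constants are then [2 pi b] and [2 pi (kappa a^2 - b^2)], and comparing them
    with the values at [psi = 0], where [Yv = 0], gives the relations between the
    far field and the boundary data.

    Reversing the orientation maps solutions to solutions (MHD_Prandtl_reverse,
    induction_relation_reverse), which reduces the statement to the case [u >= c > 0]. *)

(** Extensionality lemmas leave equalities in R seen as a normed module, which [ring]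
    and [field] recognise only once they are restated in R. *)
Ltac eq_R := match goal with |- @eq _ ?a ?b => change (@eq R a b) end.

(** * Continuity of functions of two variables and of integrals with a parameter *)

Lemma continuity_2d_pt_comp (f p q : R -> R -> R) (x y : R) :
  continuity_2d_pt f (p x y) (q x y) ->
  continuity_2d_pt p x y -> continuity_2d_pt q x y ->
  continuity_2d_pt (fun s t => f (p s t) (q s t)) x y.
Proof.
intros Hf Hp Hq eps.
destruct (Hf eps) as [d Hd].
destruct (Hp d) as [d1 H1]; destruct (Hq d) as [d2 H2].
assert (Hm : 0 < Rmin d1 d2) by (apply Rmin_pos; [apply d1 | apply d2]).
exists (mkposreal _ Hm); simpl; intros s t Hs Ht.
apply Hd; [apply H1 | apply H2]; eapply Rlt_le_trans; eauto using Rmin_l, Rmin_r.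
Qed.

Lemma continuity_2d_pt_swap (f : R -> R -> R) (x y : R) :
  continuity_2d_pt f x y -> continuity_2d_pt (fun s t => f t s) y x.
Proof.
intros H; apply (continuity_2d_pt_comp f (fun _ t => t) (fun s _ => s)).
- exact H.
- apply continuity_2d_pt_id2.
- apply continuity_2d_pt_id1.
Qed.

Lemma continuity_2d_pt_fst (f : R -> R -> R) (x y : R) :
  continuity_2d_pt f x y -> continuous (fun s => f s y) x.
Proof.
intros H; apply continuity_pt_filterlim, continuity_pt_locally; intros eps.
exact (locally_2d_1d_const_y _ _ _ (H eps)).
Qed.

Lemma continuity_2d_pt_snd (f : R -> R -> R) (x y : R) :
  continuity_2d_pt f x y -> continuous (fun t => f x t) y.
Proof.
intros H; apply continuity_pt_filterlim, continuity_pt_locally; intros eps.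
exact (locally_2d_1d_const_x _ _ _ (H eps)).
Qed.

Lemma ex_RInt_fst (w : R -> R -> R) (a b y : R) :
  (forall s, continuity_2d_pt w s y) -> ex_RInt (fun s => w s y) a b.
Proof.
intros H; apply (ex_RInt_continuous (V := R_CompleteNormedModule)); intros s _.
apply continuity_2d_pt_fst, H.
Qed.

Lemma ex_RInt_snd (w : R -> R -> R) (a b x : R) :
  (forall t, continuity_2d_pt w x t) -> ex_RInt (fun t => w x t) a b.
Proof.
intros H; apply (ex_RInt_continuous (V := R_CompleteNormedModule)); intros s _.
apply continuity_2d_pt_snd, H.
Qed.

(** Differentiation under the integral sign, over an open set [D] of parameters so that it
    applies to functions whose derivatives exist only for [Y < 0]. *)
Lemma is_derive_RInt_snd (D : R -> Prop) (w wy : R -> R -> R) (a b y : R) :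
  open D -> D y ->
  (forall s z, D z -> is_derive (fun t => w s t) z (wy s z)) ->
  (forall s z, D z -> continuity_2d_pt w s z) ->
  (forall s z, D z -> continuity_2d_pt wy s z) ->
  is_derive (fun z => RInt (fun s => w s z) a b) y (RInt (fun s => wy s y) a b).
Proof.
intros HD Hy Hd Hc Hc'.
assert (HDy := HD y Hy).
rewrite (RInt_ext (fun s => wy s y) (fun s => Derive (fun t => w s t) y)).
2: { intros s _; symmetry; apply is_derive_unique, Hd, Hy. }
apply (is_derive_RInt_param (fun z s => w s z)).
- apply (filter_imp D); [| exact HDy]; intros z Hz s _; exists (wy s z); auto.
- intros s _; apply (continuity_2d_pt_ext_loc (fun z s => wy s z)).
  + destruct HDy as [d H]; exists d; intros z t Hz _.
    symmetry; apply is_derive_unique, Hd, H, Hz.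
  + apply (continuity_2d_pt_swap wy), Hc', Hy.
- apply (filter_imp D); [| exact HDy]; intros z Hz; apply ex_RInt_fst; auto.
Qed.

Lemma continuous_RInt_snd (D : R -> Prop) (w : R -> R -> R) (a b y : R) :
  open D -> D y ->
  (forall s z, D z -> continuity_2d_pt w s z) ->
  continuous (fun z => RInt (fun s => w s z) a b) y.
Proof.
intros HD Hy Hc; apply continuity_pt_filterlim, continuity_pt_locally; intros eps.
(* The added 1 keeps the denominator positive when [a = b]. *)
assert (He : 0 < eps / (Rabs (b - a) + 1)).
{ apply Rdiv_lt_0_compat; [apply eps |]. generalize (Rabs_pos (b - a)); lra. }
destruct (uniform_continuity_2d_1d w (Rmin a b) (Rmax a b) y
            (fun s _ => Hc s y Hy) (mkposreal _ He)) as [d Hd].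
apply (filter_imp (fun z => D z /\ ball y d z)).
2: { apply filter_and; [apply HD, Hy | apply locally_ball]. }
intros z [Dz Hz]; change (Rabs (z - y) < d) in Hz.
assert (E : RInt (fun s => w s z) a b - RInt (fun s => w s y) a b
            = RInt (fun s => w s z - w s y) a b).
{ symmetry; apply (RInt_minus (fun s => w s z) (fun s => w s y));
  apply ex_RInt_fst; auto. }
rewrite E.
eapply Rle_lt_trans.
- apply (norm_RInt_le_const_abs (fun s => w s z - w s y) a b _
           (eps / (Rabs (b - a) + 1))).
  + intros s Hs; left.
    apply Rabs_def2 in Hz; destruct Hz as [Hz1 Hz2]; assert (Hd0 := cond_pos d).
    apply (Hd s y s z); try exact Hs; try lra.
    rewrite Rminus_diag, Rabs_R0; exact Hd0.
  + apply (RInt_correct (V := R_CompleteNormedModule)).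
    apply (ex_RInt_continuous (V := R_CompleteNormedModule)); intros s _.
    apply (continuous_minus (fun s => w s z) (fun s => w s y));
    apply continuity_2d_pt_fst, Hc; assumption.
- destruct eps as [eps Heps]; simpl in *.
  generalize (Rabs_pos (b - a)); intros Hp.
  apply Rmult_lt_reg_r with (Rabs (b - a) + 1); [lra |].
  replace (Rabs (b - a) * (eps / (Rabs (b - a) + 1)) * (Rabs (b - a) + 1))
    with (Rabs (b - a) * eps) by (field; lra).
  nra.
Qed.

Lemma continuous_RInt_snd_global (w : R -> R -> R) (a b y : R) :
  (forall s z, continuity_2d_pt w s z) ->
  continuous (fun z => RInt (fun s => w s z) a b) y.
Proof.
intros Hc; apply (continuous_RInt_snd (fun _ => True)); auto; apply open_true.
Qed.

(** * Functions that are continuously differentiable below the boundary *)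

(** The partial derivatives are carried as explicit functions, so that the equations can be
    manipulated as identities between real numbers. *)
Record C1_below (w wt wY : R -> R -> R) : Prop := {
  C1_dt : forall s Y, Y < 0 -> is_derive (fun t => w t Y) s (wt s Y);
  C1_dY : forall s Y, Y < 0 -> is_derive (fun z => w s z) Y (wY s Y);
  C1_c : forall s Y, Y < 0 -> continuity_2d_pt w s Y;
  C1_ct : forall s Y, Y < 0 -> continuity_2d_pt wt s Y;
  C1_cY : forall s Y, Y < 0 -> continuity_2d_pt wY s Y
}.

Arguments C1_dt {w wt wY}.
Arguments C1_dY {w wt wY}.
Arguments C1_c {w wt wY}.
Arguments C1_ct {w wt wY}.
Arguments C1_cY {w wt wY}.

Lemma C1_below_minus {w1 w1t w1Y w2 w2t w2Y} :
  C1_below w1 w1t w1Y -> C1_below w2 w2t w2Y ->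
  C1_below (fun s Y => w1 s Y - w2 s Y) (fun s Y => w1t s Y - w2t s Y)
           (fun s Y => w1Y s Y - w2Y s Y).
Proof.
intros H1 H2; split; intros s Y HY.
- apply (is_derive_minus (K := R_AbsRing) (V := R_NormedModule));
  [apply (C1_dt H1) | apply (C1_dt H2)]; auto.
- apply (is_derive_minus (K := R_AbsRing) (V := R_NormedModule));
  [apply (C1_dY H1) | apply (C1_dY H2)]; auto.
- apply continuity_2d_pt_minus; [apply (C1_c H1) | apply (C1_c H2)]; auto.
- apply continuity_2d_pt_minus; [apply (C1_ct H1) | apply (C1_ct H2)]; auto.
- apply continuity_2d_pt_minus; [apply (C1_cY H1) | apply (C1_cY H2)]; auto.
Qed.

Lemma C1_below_mult {w1 w1t w1Y w2 w2t w2Y} :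
  C1_below w1 w1t w1Y -> C1_below w2 w2t w2Y ->
  C1_below (fun s Y => w1 s Y * w2 s Y)
           (fun s Y => w1t s Y * w2 s Y + w1 s Y * w2t s Y)
           (fun s Y => w1Y s Y * w2 s Y + w1 s Y * w2Y s Y).
Proof.
intros H1 H2; split; intros s Y HY.
- apply (is_derive_mult (fun t => w1 t Y) (fun t => w2 t Y));
  [apply (C1_dt H1) | apply (C1_dt H2) | exact Rmult_comm]; auto.
- apply (is_derive_mult (fun t => w1 s t) (fun t => w2 s t));
  [apply (C1_dY H1) | apply (C1_dY H2) | exact Rmult_comm]; auto.
- apply continuity_2d_pt_mult; [apply (C1_c H1) | apply (C1_c H2)]; auto.
- apply continuity_2d_pt_plus; apply continuity_2d_pt_mult;
  eauto using C1_c, C1_ct.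
- apply continuity_2d_pt_plus; apply continuity_2d_pt_mult;
  eauto using C1_c, C1_cY.
Qed.

Lemma C1_below_inv w wt wY :
  (forall s Y, Y < 0 -> w s Y <> 0) -> C1_below w wt wY ->
  C1_below (fun s Y => / w s Y) (fun s Y => - wt s Y / (w s Y) ^ 2)
           (fun s Y => - wY s Y / (w s Y) ^ 2).
Proof.
intros H0 H.
assert (Hc : forall s Y, Y < 0 -> continuity_2d_pt (fun s Y => / (w s Y) ^ 2) s Y).
{ intros s Y HY; apply continuity_2d_pt_inv.
  - apply (continuity_2d_pt_ext (fun s Y => w s Y * w s Y)); [intros; ring |].
    apply continuity_2d_pt_mult; apply (C1_c H); auto.
  - apply pow_nonzero; auto. }
split; intros s Y HY.
- apply (is_derive_inv (fun t => w t Y)); [apply (C1_dt H) |]; auto.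
- apply (is_derive_inv (fun t => w s t)); [apply (C1_dY H) |]; auto.
- apply continuity_2d_pt_inv; [apply (C1_c H) |]; auto.
- apply continuity_2d_pt_mult; [apply continuity_2d_pt_opp |]; eauto using C1_ct.
- apply continuity_2d_pt_mult; [apply continuity_2d_pt_opp |]; eauto using C1_cY.
Qed.

Lemma C1_below_const k : C1_below (fun _ _ => k) (fun _ _ => 0) (fun _ _ => 0).
Proof.
split; intros s Y _; try apply continuity_2d_pt_const;
exact (is_derive_const (K := R_AbsRing) k _).
Qed.

Lemma locally_2d_below (P : R -> R -> Prop) s Y :
  (forall t z, z < 0 -> P t z) -> Y < 0 -> locally_2d P s Y.
Proof.
intros HP HY; assert (Hp : 0 < - Y) by lra.
exists (mkposreal _ Hp); simpl; intros t z _ Hz; apply HP.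
apply Rabs_def2 in Hz; lra.
Qed.

Lemma C1_below_ext w wt wY w' wt' wY' :
  (forall s Y, Y < 0 -> w s Y = w' s Y) ->
  (forall s Y, Y < 0 -> wt s Y = wt' s Y) ->
  (forall s Y, Y < 0 -> wY s Y = wY' s Y) ->
  C1_below w wt wY -> C1_below w' wt' wY'.
Proof.
intros E Et EY H; split; intros s Y HY.
- rewrite <- Et by auto; apply (is_derive_ext (fun t => w t Y)); [intros; apply E, HY |].
  apply (C1_dt H), HY.
- rewrite <- EY by auto; apply (is_derive_ext_loc (fun z => w s z)).
  + apply (filter_imp (fun z => z < 0)); [intros; apply E; auto | apply open_lt, HY].
  + apply (C1_dY H), HY.
- apply (continuity_2d_pt_ext_loc w); [| apply (C1_c H), HY].
  apply locally_2d_below; auto.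
- apply (continuity_2d_pt_ext_loc wt); [| apply (C1_ct H), HY].
  apply locally_2d_below; auto.
- apply (continuity_2d_pt_ext_loc wY); [| apply (C1_cY H), HY].
  apply locally_2d_below; auto.
Qed.

Lemma C1_below_is_derive_comp w wt wY (p q : R -> R) s dp dq :
  C1_below w wt wY -> q s < 0 -> is_derive p s dp -> is_derive q s dq ->
  is_derive (fun t => w (p t) (q t)) s (wt (p s) (q s) * dp + wY (p s) (q s) * dq).
Proof.
intros H Hq Hdp Hdq.
apply is_derive_Reals, (derivable_pt_lim_comp_2d w p q).
- apply filterdiff_differentiable_pt_lim.
  apply (is_derive_filterdiff w (p s) (q s) wt).
  + apply (locally_2d_locally (fun a b => is_derive (fun z => w z b) a (wt a b))).
    assert (Hp : 0 < - q s) by lra.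
    exists (mkposreal _ Hp); simpl; intros a b _ Hb; apply Rabs_def2 in Hb.
    apply (C1_dt H); lra.
  + apply (C1_dY H), Hq.
  + apply continuity_2d_pt_filterlim, (C1_ct H), Hq.
- apply is_derive_Reals, Hdp.
- apply is_derive_Reals, Hdq.
Qed.

(** * The stream function *)

(** The difference quotient of a primitive of [f], extended continuously to [a = b]; it turns
    implicit differentiation into a continuity argument. *)
Definition mean (f : R -> R) (a b : R) : R := RInt (fun t => f (a + t * (b - a))) 0 1.

Lemma mean_mult (f : R -> R) (a b : R) :
  (forall x, continuous f x) -> mean f a b * (b - a) = RInt f a b.
Proof.
intros Hf; unfold mean.
replace (RInt f a b) with (RInt f ((b - a) * 0 + a) ((b - a) * 1 + a)) by (f_equal; ring).
rewrite <- (RInt_comp_lin (V := R_CompleteNormedModule)).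
2: { apply (ex_RInt_continuous (V := R_CompleteNormedModule)); auto. }
rewrite (RInt_scal (V := R_CompleteNormedModule) (fun y => f ((b - a) * y + a))).
- unfold scal; simpl; unfold mult; simpl; rewrite Rmult_comm; f_equal.
  apply RInt_ext; intros t _; f_equal; ring.
- apply (ex_RInt_continuous (V := R_CompleteNormedModule)); intros t _.
  apply continuous_comp; [| apply Hf].
  apply (continuous_plus (V := R_NormedModule)); [| apply continuous_const].
  apply (continuous_mult (K := R_AbsRing)); [apply continuous_const | apply continuous_id].
Qed.

Lemma mean_point (f : R -> R) (a : R) : mean f a a = f a.
Proof.
unfold mean; rewrite (RInt_ext _ (fun _ => f a)).
- rewrite RInt_const; unfold scal; simpl; unfold mult; simpl; ring.
- intros t _; f_equal; ring.
Qed.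

Lemma mean_ge (f : R -> R) (c a b : R) :
  (forall x, continuous f x) -> (forall x, c <= f x) -> c <= mean f a b.
Proof.
intros Hf Hc.
replace c with (RInt (fun _ => c) 0 1).
2: { rewrite RInt_const; unfold scal; simpl; unfold mult; simpl; ring. }
apply RInt_le; try lra.
- apply ex_RInt_const.
- apply (ex_RInt_continuous (V := R_CompleteNormedModule)); intros t _.
  apply (continuous_comp (fun t => a + t * (b - a)) f); [| apply Hf].
  apply (continuous_plus (V := R_NormedModule)); [apply continuous_const |].
  apply (continuous_mult (K := R_AbsRing)); [apply continuous_id | apply continuous_const].
- auto.
Qed.

Lemma continuous_mean (w : R -> R -> R) (p q : R -> R) (a x : R) :
  (forall s t, continuity_2d_pt w s t) ->
  (forall x, continuous p x) -> (forall x, continuous q x) ->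
  continuous (fun x => mean (fun z => w (p x) z) a (q x)) x.
Proof.
intros Hw Hp Hq; unfold mean.
apply (continuous_RInt_snd_global (fun t x => w (p x) (a + t * (q x - a)))).
intros s t.
assert (H1 : forall r : R -> R, (forall x, continuous r x) ->
             continuity_2d_pt (fun _ z => r z) s t).
{ intros r Hr; apply (continuity_1d_2d_pt_comp r (fun _ z => z)).
  - apply continuity_pt_filterlim, Hr.
  - apply continuity_2d_pt_id2. }
apply (continuity_2d_pt_comp w (fun _ z => p z) (fun s z => a + s * (q z - a))); auto.
apply continuity_2d_pt_plus; [apply continuity_2d_pt_const |].
apply continuity_2d_pt_mult; [apply continuity_2d_pt_id1 |].
apply continuity_2d_pt_minus; [auto | apply continuity_2d_pt_const].
Qed.

(** Caratheodory's form of differentiability: a difference quotient that extends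
    continuously to [x0] gives the derivative there. *)
Lemma is_derive_slope (q sl : R -> R) (x0 : R) :
  (forall x, q x - q x0 = sl x * (x - x0)) -> continuous sl x0 ->
  is_derive q x0 (sl x0).
Proof.
intros E Hc; apply is_derive_Reals; intros eps Heps.
apply continuity_pt_filterlim in Hc.
destruct (proj1 (continuity_pt_locally sl x0) Hc (mkposreal _ Heps)) as [d Hd].
exists d; intros h Hh Hhd.
replace ((q (x0 + h) - q x0) / h - sl x0) with (sl (x0 + h) - sl x0).
- apply Hd; change (Rabs (x0 + h - x0) < d); replace (x0 + h - x0) with h by ring; auto.
- rewrite E; field; auto.
Qed.

(** The velocity field of an oriented flow.  Up to the boundary only continuity is
    available, and [u], [v] are taken continuous on the whole plane, which restriction to
    the half-plane and constant extension achieve.  The divergence-free condition is stated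
    as the value of [v_Y]. *)
Record stream (c : R) (u v ut uY : R -> R -> R) : Prop := {
  st_c : 0 < c;
  st_ge : forall s Y, c <= u s Y;
  st_u : forall s Y, continuity_2d_pt u s Y;
  st_v : forall s Y, continuity_2d_pt v s Y;
  st_v0 : forall s, v s 0 = 0;
  st_per : forall Y, periodic (fun s => u s Y);
  st_C1 : C1_below u ut uY;
  st_div : forall s Y, Y < 0 -> is_derive (fun z => v s z) Y (- ut s Y)
}.

Arguments st_c {c u v ut uY}. Arguments st_ge {c u v ut uY}.
Arguments st_u {c u v ut uY}. Arguments st_v {c u v ut uY}.
Arguments st_v0 {c u v ut uY}. Arguments st_per {c u v ut uY}.
Arguments st_C1 {c u v ut uY}. Arguments st_div {c u v ut uY}.

Lemma von_Mises_dY {c u v ut uY} (S : stream c u v ut uY) s Y :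
  is_derive (von_Mises u s) Y (u s Y).
Proof.
unfold von_Mises; apply (is_derive_RInt (V := R_NormedModule) (fun z => u s z) _ 0).
- apply filter_forall; intros z; apply (RInt_correct (V := R_CompleteNormedModule)).
  apply ex_RInt_snd; intros; apply (st_u S).
- apply continuity_2d_pt_snd, (st_u S).
Qed.

Lemma von_Mises_diff {c u v ut uY} (S : stream c u v ut uY) s Y1 Y2 :
  von_Mises u s Y2 - von_Mises u s Y1 = mean (u s) Y1 Y2 * (Y2 - Y1).
Proof.
rewrite mean_mult by (intros; apply continuity_2d_pt_snd, (st_u S)).
assert (Hex : forall a b, ex_RInt (u s) a b).
{ intros; apply ex_RInt_snd; intros; apply (st_u S). }
unfold von_Mises; rewrite <- (RInt_Chasles (V := R_CompleteNormedModule) _ 0 Y1 Y2) by auto.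
unfold plus; simpl; change (fun z => u s z) with (u s); ring.
Qed.

Lemma mean_u_ge {c u v ut uY} (S : stream c u v ut uY) s Y1 Y2 : c <= mean (u s) Y1 Y2.
Proof.
apply mean_ge; [intros; apply continuity_2d_pt_snd, (st_u S) | apply (st_ge S)].
Qed.

(** This bound gives both the injectivity of the change of variables and the Lipschitz
    continuity of its inverse. *)
Lemma von_Mises_expand {c u v ut uY} (S : stream c u v ut uY) s Y1 Y2 :
  c * Rabs (Y2 - Y1) <= Rabs (von_Mises u s Y2 - von_Mises u s Y1).
Proof.
rewrite (von_Mises_diff S), Rabs_mult.
apply Rmult_le_compat_r; [apply Rabs_pos |].
eapply Rle_trans; [apply (mean_u_ge S s Y1 Y2) | apply Rle_abs].
Qed.

Lemma von_Mises_0 u s : von_Mises u s 0 = 0.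
Proof. unfold von_Mises; apply (RInt_point (V := R_CompleteNormedModule)). Qed.

Lemma eq_left_of_0 (D : R -> R) :
  (forall Y, continuous D Y) -> (forall Y, Y < 0 -> is_derive D Y 0) ->
  forall Y, Y <= 0 -> D Y = D 0.
Proof.
intros Hc Hd Y HY.
destruct (MVT_gen D Y 0 (fun _ => 0)) as [x [_ E]].
- intros x Hx; apply Hd; rewrite Rmax_right in Hx by lra; lra.
- intros x _; apply continuity_pt_filterlim, Hc.
- lra.
Qed.

(** The stream function has [theta]-derivative [- v], in integrated form.  The derivative
    [u_theta] need not be bounded near [Y = 0], so one does not differentiate under the
    integral from [0]: the difference of the two sides has zero [Y]-derivative below the
    boundary, is continuous up to it, and vanishes there. *)
Lemma von_Mises_flux {c u v ut uY} (S : stream c u v ut uY) s1 s2 Y :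
  Y <= 0 -> von_Mises u s2 Y - von_Mises u s1 Y = - RInt (fun s => v s Y) s1 s2.
Proof.
intros HY.
assert (Hcm : forall s z, continuous (von_Mises u s) z).
{ intros s z; apply (ex_derive_continuous (V := R_NormedModule)); eexists;
  apply (von_Mises_dY S). }
set (D := fun z => von_Mises u s2 z - von_Mises u s1 z + RInt (fun s => v s z) s1 s2).
assert (E : D Y = D 0).
{ apply eq_left_of_0; auto.
  - intros z; unfold D.
    apply (continuous_plus (V := R_NormedModule)).
    + apply (continuous_minus (V := R_NormedModule)); apply Hcm.
    + apply continuous_RInt_snd_global, (st_v S).
  - intros z Hz; unfold D.
    assert (Hu : RInt (fun s => - ut s z) s1 s2 = - (u s2 z - u s1 z)).
    { rewrite (RInt_opp (V := R_CompleteNormedModule) (fun s => ut s z)).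
      - unfold opp; simpl; f_equal; apply is_RInt_unique.
        apply (is_RInt_derive (V := R_CompleteNormedModule) (fun s => u s z)).
        + intros s _; apply (C1_dt (st_C1 S)), Hz.
        + intros s _; apply (continuity_2d_pt_fst ut), (C1_ct (st_C1 S)), Hz.
      - apply ex_RInt_fst; intros; apply (C1_ct (st_C1 S)), Hz. }
    replace 0 with (u s2 z - u s1 z + RInt (fun s => - ut s z) s1 s2) by (rewrite Hu; ring).
    apply (is_derive_plus (K := R_AbsRing) (V := R_NormedModule)).
    + exact (is_derive_minus (K := R_AbsRing) (V := R_NormedModule) _ _ _ _ _
               (von_Mises_dY S s2 z) (von_Mises_dY S s1 z)).
    + apply (is_derive_RInt_snd (fun z => z < 0) v (fun s z => - ut s z)).
      * apply open_lt.
      * exact Hz.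
      * apply (st_div S).
      * intros; apply (st_v S).
      * intros; apply continuity_2d_pt_opp, (C1_ct (st_C1 S)); auto. }
assert (E0 : D 0 = 0).
{ unfold D; rewrite !von_Mises_0, (RInt_ext _ (fun _ => 0)).
  - rewrite RInt_const; unfold scal; simpl; unfold mult; simpl; ring.
  - intros s _; apply (st_v0 S). }
unfold D in E at 1; lra.
Qed.

Lemma von_Mises_periodic {c u v ut uY} (S : stream c u v ut uY) Y :
  periodic (fun s => von_Mises u s Y).
Proof.
intros s; unfold von_Mises; apply RInt_ext; intros z _; apply (st_per S).
Qed.

(** As [u >= c > 0], the stream function at fixed [theta] reaches [psi] within distance
    [|psi| / c] of the boundary. *)
Lemma von_Mises_onto {c u v ut uY} (S : stream c u v ut uY) :
  exists Yv, forall s psi, von_Mises u s (Yv s psi) = psi.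
Proof.
assert (H : forall s psi, {Y | von_Mises u s Y = psi}).
{ intros s psi.
  assert (Hc := st_c S).
  set (M := Rabs psi / c).
  assert (HM : 0 <= M) by (apply Rdiv_le_0_compat; [apply Rabs_pos | exact Hc]).
  assert (HcM : c * M = Rabs psi) by (unfold M; field; lra).
  destruct (IVT_cor (fun Y => von_Mises u s Y - psi) (- M) M) as [Y [_ HY]].
  - intros z; apply continuity_pt_filterlim.
    apply (continuous_minus (V := R_NormedModule)); [| apply continuous_const].
    apply (ex_derive_continuous (V := R_NormedModule)); eexists;
    apply (von_Mises_dY S).
  - lra.
  - assert (H1 := von_Mises_diff S s 0 M).
    assert (H2 := von_Mises_diff S s 0 (- M)).
    assert (G1 := mean_u_ge S s 0 M).
    assert (G2 := mean_u_ge S s 0 (- M)).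
    rewrite von_Mises_0 in H1, H2.
    assert (B := Rabs_maj2 psi); assert (B' := Rle_abs psi).
    assert (von_Mises u s M >= c * M) by nra.
    assert (von_Mises u s (- M) <= - (c * M)) by nra.
    nra.
  - exists Y; lra. }
exists (fun s psi => proj1_sig (H s psi)); intros s psi; apply (proj2_sig (H s psi)).
Qed.

(** * The von Mises change of variables *)

(** Required for every real [psi], unlike in [von_Mises_inverse]: the velocity is extended
    above the boundary, and [Yv] is then defined and continuous on the whole plane. *)
Definition right_inverse (u Yv : R -> R -> R) : Prop :=
  forall s psi, von_Mises u s (Yv s psi) = psi.

Lemma von_Mises_cancel {c u v ut uY Yv} (S : stream c u v ut uY) (I : right_inverse u Yv) s Y :
  Yv s (von_Mises u s Y) = Y.
Proof.
assert (H := von_Mises_expand S s Y (Yv s (von_Mises u s Y))).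
rewrite I, Rminus_diag, Rabs_R0 in H.
assert (Hc := st_c S).
assert (P := Rabs_pos (Yv s (von_Mises u s Y) - Y)).
apply Rminus_diag_uniq; destruct (Req_dec (Yv s (von_Mises u s Y) - Y) 0) as [E | N]; auto.
apply Rabs_pos_lt in N; nra.
Qed.

Lemma von_Mises_factor {c u v ut uY} (S : stream c u v ut uY) s Y :
  exists m, c <= m /\ von_Mises u s Y = m * Y.
Proof.
exists (mean (u s) 0 Y); split; [apply (mean_u_ge S) |].
assert (H := von_Mises_diff S s 0 Y).
rewrite von_Mises_0 in H; lra.
Qed.

Lemma Yv_neg {c u v ut uY Yv} (S : stream c u v ut uY) (I : right_inverse u Yv) s psi :
  psi < 0 -> Yv s psi < 0.
Proof.
intros H; destruct (von_Mises_factor S s (Yv s psi)) as [m [Hm E]].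
rewrite I in E; assert (Hc := st_c S).
destruct (Rlt_le_dec (Yv s psi) 0); auto; nra.
Qed.

Lemma Yv_0 {c u v ut uY Yv} (S : stream c u v ut uY) (I : right_inverse u Yv) s :
  Yv s 0 = 0.
Proof.
assert (H := von_Mises_cancel S I s 0).
rewrite von_Mises_0 in H; exact H.
Qed.

Lemma Yv_npos {c u v ut uY Yv} (S : stream c u v ut uY) (I : right_inverse u Yv) s psi :
  psi <= 0 -> Yv s psi <= 0.
Proof.
intros [H | ->]; [left; apply (Yv_neg S I _ _ H) |].
rewrite (Yv_0 S I); lra.
Qed.

Lemma von_Mises_inverse_of_right {c u v ut uY Yv} :
  stream c u v ut uY -> right_inverse u Yv -> von_Mises_inverse u Yv.
Proof.
intros S I; split; intros s Y HY.
- split; [| apply (von_Mises_cancel S I)].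
  destruct (von_Mises_factor S s Y) as [m [Hm E]].
  assert (Hc := st_c S); nra.
- split; [apply (Yv_npos S I), HY | apply I].
Qed.

Lemma continuous_von_Mises_fst {c u v ut uY} (S : stream c u v ut uY) s Y :
  continuous (fun t => von_Mises u t Y) s.
Proof.
apply (continuous_RInt_snd_global (fun z t => u t z)).
intros z t; apply (continuity_2d_pt_swap u), (st_u S).
Qed.

(** By von_Mises_expand on the slice of the moving [theta], the increment of [Yv] is
    controlled by the increment of [psi] and by the variation in [theta] of the stream
    function at fixed [Y]. *)
Lemma continuity_Yv {c u v ut uY Yv} (S : stream c u v ut uY) (I : right_inverse u Yv) s psi :
  continuity_2d_pt Yv s psi.
Proof.
intros [eps Heps]; simpl.
assert (Hc := st_c S).
set (Y := Yv s psi).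
assert (He : 0 < c * eps / 2) by nra.
assert (Hv := continuous_von_Mises_fst S s Y).
apply continuity_pt_filterlim in Hv.
destruct (proj1 (continuity_pt_locally _ s) Hv (mkposreal _ He)) as [d Hd]; simpl in Hd.
assert (Hm : 0 < Rmin d (c * eps / 2)) by (apply Rmin_pos; [apply d | exact He]).
exists (mkposreal _ Hm); simpl; intros s' psi' Hs Hpsi.
assert (H1 : Rabs (von_Mises u s' Y - von_Mises u s Y) < c * eps / 2).
{ apply Hd; eapply Rlt_le_trans; [exact Hs | apply Rmin_l]. }
assert (H2 : Rabs (psi' - psi) < c * eps / 2).
{ eapply Rlt_le_trans; [exact Hpsi | apply Rmin_r]. }
assert (H3 := von_Mises_expand S s' Y (Yv s' psi')).
rewrite I in H3; replace (von_Mises u s Y) with psi in H1 by (symmetry; apply I).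
apply Rmult_lt_reg_l with c; [exact Hc |].
eapply Rle_lt_trans; [exact H3 |].
replace (psi' - von_Mises u s' Y) with ((psi' - psi) - (von_Mises u s' Y - psi)) by ring.
unfold Rminus at 1; eapply Rle_lt_trans; [apply Rabs_triang |].
rewrite Rabs_Ropp; lra.
Qed.

Lemma periodic_Yv {c u v ut uY Yv} (S : stream c u v ut uY) (I : right_inverse u Yv) psi :
  periodic (fun s => Yv s psi).
Proof.
intros s.
rewrite <- (von_Mises_cancel S I s (Yv (s + 2 * PI) psi)).
rewrite <- (von_Mises_periodic S (Yv (s + 2 * PI) psi) s), I; reflexivity.
Qed.

Lemma is_derive_Yv_psi {c u v ut uY Yv} (S : stream c u v ut uY) (I : right_inverse u Yv) s psi :
  is_derive (fun z => Yv s z) psi (/ u s (Yv s psi)).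
Proof.
assert (Hc := st_c S).
set (sl := fun z => / mean (u s) (Yv s psi) (Yv s z)).
replace (/ u s (Yv s psi)) with (sl psi) by (unfold sl; rewrite mean_point; reflexivity).
apply is_derive_slope.
- intros z; unfold sl.
  assert (H := von_Mises_diff S s (Yv s psi) (Yv s z)).
  assert (G := mean_u_ge S s (Yv s psi) (Yv s z)).
  rewrite !I in H; rewrite H; field; lra.
- apply (continuous_comp (fun z => mean (u s) (Yv s psi) (Yv s z)) Rinv).
  + apply (continuous_mean u (fun _ => s) (fun z => Yv s z)); [apply (st_u S) | |].
    * intros; apply continuous_const.
    * intros; apply continuity_2d_pt_snd, (continuity_Yv S I).
  + apply continuous_Rinv; assert (G := mean_u_ge S s (Yv s psi) (Yv s psi)); lra.
Qed.

(** A streamline has slope [v / u].  At fixed [psi], the increment of the stream function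
    due to the change of [Y] compensates the one due to the change of [theta]; each of
    them is an increment times a mean, of [u] and of [v]. *)
Lemma is_derive_Yv_theta {c u v ut uY Yv} (S : stream c u v ut uY) (I : right_inverse u Yv)
  s psi :
  psi <= 0 ->
  is_derive (fun t => Yv t psi) s (v s (Yv s psi) / u s (Yv s psi)).
Proof.
intros Hpsi.
assert (Hc := st_c S).
set (Y := Yv s psi).
assert (HY : Y <= 0) by apply (Yv_npos S I _ _ Hpsi).
set (sl := fun t => mean (fun z => v z Y) s t / mean (u t) Y (Yv t psi)).
replace (v s Y / u s Y) with (sl s) by (unfold sl; fold Y; rewrite !mean_point; reflexivity).
apply is_derive_slope.
- intros t; unfold sl; fold Y.
  assert (H := von_Mises_diff S t Y (Yv t psi)).
  assert (G := mean_u_ge S t Y (Yv t psi)).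
  assert (F := von_Mises_flux S s t Y HY).
  rewrite <- mean_mult in F by (intros; apply (continuity_2d_pt_fst v), (st_v S)).
  rewrite I in H; replace (von_Mises u s Y) with psi in F by (symmetry; apply I).
  apply Rmult_eq_reg_l with (mean (u t) Y (Yv t psi)); [| lra].
  field_simplify; [| lra]; lra.
- unfold Rdiv.
  apply (continuous_mult (K := R_AbsRing) (fun t => mean (fun z => v z Y) s t)
           (fun t => / mean (u t) Y (Yv t psi))).
  + apply (continuous_mean (fun y z => v z y) (fun _ => Y) (fun t => t)).
    * intros; apply (continuity_2d_pt_swap v), (st_v S).
    * intros; apply continuous_const.
    * intros; apply continuous_id.
  + apply (continuous_comp (fun t => mean (u t) Y (Yv t psi)) Rinv).
    * apply (continuous_mean u (fun t => t) (fun t => Yv t psi)); [apply (st_u S) | |].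
      -- intros; apply continuous_id.
      -- intros; apply (continuity_2d_pt_fst Yv), (continuity_Yv S I).
    * apply continuous_Rinv; assert (G := mean_u_ge S s Y (Yv s psi)); lra.
Qed.

Lemma continuity_pull {c u v ut uY Yv} (S : stream c u v ut uY) (I : right_inverse u Yv) w s psi :
  continuity_2d_pt w s (Yv s psi) -> continuity_2d_pt (fun t z => w t (Yv t z)) s psi.
Proof.
intros Hw; apply (continuity_2d_pt_comp w (fun t _ => t) Yv); auto.
- apply continuity_2d_pt_id1.
- apply (continuity_Yv S I).
Qed.

Lemma is_derive_theta_integral {c u v ut uY Yv w wt wY}
  (S : stream c u v ut uY) (I : right_inverse u Yv) psi :
  C1_below w wt wY -> psi < 0 ->
  is_derive (theta_integral (fun s z => w s (Yv s z))) psi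
    (theta_integral (fun s z => wY s (Yv s z) / u s (Yv s z)) psi).
Proof.
intros Hw Hpsi; assert (Hc := st_c S).
apply (is_derive_RInt_snd (fun z => z < 0) (fun s z => w s (Yv s z))
         (fun s z => wY s (Yv s z) / u s (Yv s z))).
- apply open_lt.
- exact Hpsi.
- intros s z Hz; assert (HY := Yv_neg S I s z Hz).
  rewrite Rdiv_def, Rmult_comm.
  apply (is_derive_comp (V := R_NormedModule) (fun y => w s y) (fun z => Yv s z)).
  + apply (C1_dY Hw), HY.
  + apply (is_derive_Yv_psi S I).
- intros s z Hz; apply (continuity_pull S I).
  apply (C1_c Hw), (Yv_neg S I), Hz.
- intros s z Hz; apply (continuity_pull S I (fun s y => wY s y / u s y)).
  apply continuity_2d_pt_mult.
  + apply (C1_cY Hw), (Yv_neg S I), Hz.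
  + apply continuity_2d_pt_inv; [apply (st_u S) |].
    assert (G := st_ge S s (Yv s z)); lra.
Qed.

(** On a streamline the material derivative [w_theta + (v / u) w_Y] is the total
    derivative of [w] in [theta], and both [w] and the streamline are periodic. *)
Lemma theta_integral_material {c u v ut uY Yv w wt wY}
  (S : stream c u v ut uY) (I : right_inverse u Yv) psi :
  C1_below w wt wY -> (forall Y, Y < 0 -> periodic (fun s => w s Y)) -> psi < 0 ->
  theta_integral (fun s z => wt s (Yv s z) + wY s (Yv s z) * (v s (Yv s z) / u s (Yv s z))) psi
  = 0.
Proof.
intros Hw Hper Hpsi; assert (Hc := st_c S).
assert (HY : forall s, Yv s psi < 0) by (intros; apply (Yv_neg S I), Hpsi).
unfold theta_integral.
transitivity (w (2 * PI) (Yv (2 * PI) psi) - w 0 (Yv 0 psi)).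
2: { replace (2 * PI) with (0 + 2 * PI) by ring.
     rewrite (periodic_Yv S I), Hper by auto; ring. }
apply is_RInt_unique.
apply (is_RInt_derive (V := R_CompleteNormedModule) (fun s => w s (Yv s psi))).
- intros s _.
  replace (wt s (Yv s psi)) with (wt s (Yv s psi) * 1) by ring.
  apply (C1_below_is_derive_comp w wt wY (fun t => t) (fun t => Yv t psi)); auto.
  + apply (is_derive_id (K := R_AbsRing)).
  + apply (is_derive_Yv_theta S I); lra.
- intros s _.
  apply (continuity_2d_pt_fst (fun s z => wt s (Yv s z)
           + wY s (Yv s z) * (v s (Yv s z) / u s (Yv s z)))).
  apply (continuity_pull S I (fun s y => wt s y + wY s y * (v s y / u s y))).
  apply continuity_2d_pt_plus; [apply (C1_ct Hw); auto |].
  apply continuity_2d_pt_mult; [apply (C1_cY Hw); auto |].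
  apply continuity_2d_pt_mult; [apply (st_v S) |].
  apply continuity_2d_pt_inv; [apply (st_u S) |].
  assert (G := st_ge S s (Yv s psi)); lra.
Qed.

(** * The two conservation laws *)

(** An oriented solution, with its equations written out for the named partial derivatives.
    In [fl_ind] the quotients of the induction equation are differentiated and [v_Y] is
    replaced by [- u_theta]. *)
Record flow (kappa e c : R) (u v g h ut uY uYt uYY gt gY gYt gYY : R -> R -> R) : Prop := {
  fl_st : stream c u v ut uY;
  fl_uY : C1_below uY uYt uYY;
  fl_g : C1_below g gt gY;
  fl_gY : C1_below gY gYt gYY;
  fl_gc : forall s Y, continuity_2d_pt g s Y;
  fl_gper : forall Y, periodic (fun s => g s Y);
  fl_mom : forall s Y, Y < 0 ->
    u s Y * ut s Y + v s Y * uY s Y - g s Y * gt s Y - h s Y * gY s Y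
    - kappa * uYY s Y = 0;
  fl_ind : forall s Y, Y < 0 ->
    gt s Y
    + (- ut s Y * g s Y / u s Y + v s Y * gY s Y / u s Y
       - v s Y * g s Y * uY s Y / u s Y ^ 2)
    - (gYY s Y / u s Y - gY s Y * uY s Y / u s Y ^ 2) = 0;
  fl_h : forall s Y, Y < 0 -> h s Y = (v s Y * g s Y - gY s Y) / u s Y + e
}.

Arguments fl_st {kappa e c u v g h ut uY uYt uYY gt gY gYt gYY}.
Arguments fl_uY {kappa e c u v g h ut uY uYt uYY gt gY gYt gYY}.
Arguments fl_g {kappa e c u v g h ut uY uYt uYY gt gY gYt gYY}.
Arguments fl_gY {kappa e c u v g h ut uY uYt uYY gt gY gYt gYY}.
Arguments fl_gc {kappa e c u v g h ut uY uYt uYY gt gY gYt gYY}.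
Arguments fl_gper {kappa e c u v g h ut uY uYt uYY gt gY gYt gYY}.
Arguments fl_mom {kappa e c u v g h ut uY uYt uYY gt gY gYt gYY}.
Arguments fl_ind {kappa e c u v g h ut uY uYt uYY gt gY gYt gYY}.
Arguments fl_h {kappa e c u v g h ut uY uYt uYY gt gY gYt gYY}.

Lemma u_neq_0 {c u v ut uY} (S : stream c u v ut uY) s Y : u s Y <> 0.
Proof. assert (H := st_ge S s Y); assert (Hc := st_c S); lra. Qed.

Lemma ex_RInt_pull {c u v ut uY Yv} (S : stream c u v ut uY) (I : right_inverse u Yv) w psi :
  (forall s Y, Y < 0 -> continuity_2d_pt w s Y) -> psi < 0 ->
  ex_RInt (fun s => w s (Yv s psi)) 0 (2 * PI).
Proof.
intros Hw Hpsi; apply (ex_RInt_fst (fun s z => w s (Yv s z))); intros s.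
apply (continuity_pull S I), Hw, (Yv_neg S I), Hpsi.
Qed.

(** A function whose second derivative vanishes on the half-line is affine there, and an
    affine function with a finite limit at infinity is constant. *)
Lemma limit_of_affine (A F : R -> R) (L : R) :
  (forall psi, continuous A psi) ->
  (forall psi, psi < 0 -> is_derive A psi (F psi)) ->
  (forall psi, psi < 0 -> is_derive F psi 0) ->
  is_lim A m_infty L ->
  (forall psi, psi < 0 -> F psi = 0) /\ (forall psi, psi <= 0 -> A psi = L).
Proof.
intros Hc HA HF HL.
assert (EF : forall p q, p < 0 -> q < 0 -> F p = F q).
{ intros p q Hp Hq.
  assert (Hm : forall x, x <= Rmax p q -> x < 0).
  { intros x Hx; eapply Rle_lt_trans; [exact Hx | apply Rmax_lub_lt; auto]. }
  destruct (MVT_gen F p q (fun _ => 0)) as [x [_ E]].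
  - intros x Hx; apply HF, Hm; lra.
  - intros x Hx; apply continuity_pt_filterlim.
    apply (ex_derive_continuous (V := R_NormedModule)); exists 0; apply HF, Hm; lra.
  - lra. }
set (m := F (-1)).
assert (EA : forall p, p <= 0 -> A p = A 0 + m * p).
{ intros p Hp.
  destruct (MVT_gen A p 0 (fun _ => m)) as [x [_ E]].
  - intros x Hx; rewrite Rmax_right in Hx by lra.
    unfold m; rewrite (EF (-1) x) by lra; apply HA; lra.
  - intros x _; apply continuity_pt_filterlim, Hc.
  - lra. }
assert (Hm : m = 0).
{ destruct (Req_dec m 0) as [| N]; auto; exfalso.
  apply is_lim_spec in HL.
  destruct (HL (mkposreal 1 Rlt_0_1)) as [M HM]; simpl in HM.
  set (p := Rmin M 0 - 1).
  assert (Hp : p < M /\ p <= -1).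
  { unfold p; split; [assert (H := Rmin_l M 0) | assert (H := Rmin_r M 0)]; lra. }
  (* Both [A p] and [A q] lie within 1 of [L], but differ by [|m| (p - q) = 2]. *)
  set (q := p - 2 / Rabs m).
  assert (Pm : 0 < Rabs m) by (apply Rabs_pos_lt, N).
  assert (P2 : 0 < 2 / Rabs m) by (apply Rdiv_lt_0_compat; lra).
  assert (H1 := HM p (proj1 Hp)).
  assert (H2 : Rabs (A q - L) < 1) by (apply HM; unfold q; lra).
  rewrite EA in H1, H2 by (unfold q; lra).
  assert (H3 : Rabs (m * (p - q)) < 2).
  { replace (m * (p - q)) with ((A 0 + m * p - L) - (A 0 + m * q - L)) by ring.
    unfold Rminus at 1; eapply Rle_lt_trans; [apply Rabs_triang |].
    rewrite Rabs_Ropp; lra. }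
  replace (p - q) with (2 / Rabs m) in H3 by (unfold q; ring).
  rewrite Rabs_mult, (Rabs_right (2 / Rabs m)) in H3 by lra.
  replace (Rabs m * (2 / Rabs m)) with 2 in H3 by (field; lra); lra. }
assert (EA0 : forall p, p <= 0 -> A p = A 0) by (intros p Hp; rewrite EA, Hm by exact Hp; ring).
split.
- intros psi Hpsi; rewrite (EF psi (-1)) by lra; exact Hm.
- assert (E : A 0 = L).
  { apply (is_lim_ext_loc A (fun _ => A 0)) in HL.
    + apply is_lim_unique in HL; rewrite Lim_const in HL; injection HL; auto.
    + exists 0; intros p Hp; apply EA0; lra. }
  intros p Hp; rewrite EA0 by exact Hp; exact E.
Qed.

Lemma continuous_theta_integral {c u v ut uY Yv} (S : stream c u v ut uY)
  (I : right_inverse u Yv) w psi :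
  (forall s Y, continuity_2d_pt w s Y) ->
  continuous (theta_integral (fun s z => w s (Yv s z))) psi.
Proof.
intros Hw; apply (continuous_RInt_snd_global (fun s z => w s (Yv s z))).
intros s z; apply (continuity_pull S I), Hw.
Qed.

(** The second derivative in [psi] of the integral of [g] is the integral of
    [(1 / u) (g_Y / u)_Y], which by the induction equation is the material derivative of
    [g / u].  The vanishing of the first derivative is what conserved_momentum needs. *)
Lemma conserved_field {kappa e c u v g h ut uY uYt uYY gt gY gYt gYY}
  (Fl : flow kappa e c u v g h ut uY uYt uYY gt gY gYt gYY) {Yv}
  (I : right_inverse u Yv) (L : R) :
  is_lim (theta_integral (fun s z => g s (Yv s z))) m_infty L ->
  (forall psi, psi < 0 ->
     theta_integral (fun s z => gY s (Yv s z) / u s (Yv s z)) psi = 0) /\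
  (forall psi, psi <= 0 -> theta_integral (fun s z => g s (Yv s z)) psi = L).
Proof.
assert (S := fl_st Fl).
assert (Hinv := C1_below_inv _ _ _ (fun s Y _ => u_neq_0 S s Y) (st_C1 S)).
apply limit_of_affine.
- intros; apply (continuous_theta_integral S I), (fl_gc Fl).
- intros psi Hpsi; apply (is_derive_theta_integral S I psi (fl_g Fl)), Hpsi.
- intros psi Hpsi.
  assert (Hq := C1_below_mult (fl_gY Fl) Hinv).
  assert (Hr := C1_below_mult (fl_g Fl) Hinv).
  assert (D1 := is_derive_theta_integral S I psi Hq Hpsi).
  assert (M := theta_integral_material S I psi Hr).
  rewrite <- M; [| | exact Hpsi].
  2: { intros Y HY s; simpl; rewrite (fl_gper Fl Y s), (st_per S Y s); reflexivity. }
  evar_last; [exact D1 |].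
  apply RInt_ext; intros s _.
  assert (HY := Yv_neg S I s psi Hpsi).
  assert (E := fl_ind Fl s _ HY).
  assert (N := u_neq_0 S s (Yv s psi)).
  set (Y := Yv s psi) in *.
  apply Rmult_eq_reg_r with (u s Y); [| exact N].
  match goal with |- ?l = ?r =>
    replace l with (gYY s Y / u s Y - gY s Y * uY s Y / u s Y ^ 2) by (field; exact N);
    replace r with (gt s Y
      + (- ut s Y * g s Y / u s Y + v s Y * gY s Y / u s Y
       - v s Y * g s Y * uY s Y / u s Y ^ 2)) by (field; exact N)
  end.
  lra.
Qed.

(** Half the second derivative in [psi] of the integral of [kappa u^2 - g^2] is the integral
    of [(1 / u) (kappa u_Y - g g_Y / u)_Y], that is of the material derivative of
    [u - g^2 / u] minus [e g_Y / u].  The last term integrates to zero because the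
    integral of [g] is constant. *)
Lemma conserved_momentum {kappa e c u v g h ut uY uYt uYY gt gY gYt gYY}
  (Fl : flow kappa e c u v g h ut uY uYt uYY gt gY gYt gYY) {Yv}
  (I : right_inverse u Yv) (L : R) :
  (forall psi, psi < 0 ->
     theta_integral (fun s z => gY s (Yv s z) / u s (Yv s z)) psi = 0) ->
  is_lim (theta_integral
    (fun s z => kappa * u s (Yv s z) ^ 2 - g s (Yv s z) ^ 2)) m_infty L ->
  forall psi, psi <= 0 ->
    theta_integral (fun s z => kappa * u s (Yv s z) ^ 2 - g s (Yv s z) ^ 2) psi = L.
Proof.
intros HA HL.
assert (S := fl_st Fl).
assert (Hu := st_C1 S); assert (Hg := fl_g Fl).
assert (Hinv := C1_below_inv _ _ _ (fun s Y _ => u_neq_0 S s Y) Hu).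
assert (Hr := C1_below_mult Hg Hinv).
assert (Hq := C1_below_mult (fl_gY Fl) Hinv).
assert (HP := C1_below_minus
  (C1_below_mult (C1_below_const kappa) (fl_uY Fl))
  (C1_below_mult Hg Hq)).
(* [HP2] is about the integrand of the first derivative in [psi] of the conserved integral,
   [HZ] about the function [u - g^2 / u] whose material derivative appears in the second. *)
assert (HP2 := C1_below_mult (C1_below_const 2) HP).
assert (HZ := C1_below_minus Hu (C1_below_mult Hg Hr)).
assert (HK : C1_below (fun s Y => kappa * u s Y ^ 2 - g s Y ^ 2)
               (fun s Y => 2 * (kappa * u s Y * ut s Y - g s Y * gt s Y))
               (fun s Y => 2 * (kappa * u s Y * uY s Y - g s Y * gY s Y))).
{ refine (C1_below_ext _ _ _ _ _ _ _ _ _ (C1_below_minus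
    (C1_below_mult (C1_below_const kappa) (C1_below_mult Hu Hu))
    (C1_below_mult Hg Hg))); intros; simpl; ring. }
apply (limit_of_affine
  (theta_integral (fun s z => kappa * u s (Yv s z) ^ 2 - g s (Yv s z) ^ 2))
  (theta_integral (fun s z => 2 *
     (kappa * uY s (Yv s z) - g s (Yv s z) * (gY s (Yv s z) * / u s (Yv s z)))))).
- intros psi; apply (continuous_theta_integral S I (fun s Y => kappa * u s Y ^ 2 - g s Y ^ 2)).
  intros s Y.
  apply (continuity_2d_pt_ext (fun s Y => kappa * (u s Y * u s Y) - g s Y * g s Y));
    [intros; ring |].
  assert (Cu := st_u S s Y); assert (Cg := fl_gc Fl s Y).
  apply continuity_2d_pt_minus; [| apply continuity_2d_pt_mult; auto].
  apply continuity_2d_pt_mult; [apply continuity_2d_pt_const |].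
  apply continuity_2d_pt_mult; auto.
- intros psi Hpsi.
  evar_last; [exact (is_derive_theta_integral S I psi HK Hpsi) |].
  apply RInt_ext; intros s _; eq_R; simpl; field; apply (u_neq_0 S).
- intros psi Hpsi.
  assert (M := theta_integral_material S I psi HZ).
  assert (D1 := is_derive_theta_integral S I psi HP2 Hpsi).
  evar_last; [exact D1 |].
  assert (X1 := ex_RInt_pull S I (fun s Y => _ + _ * (v s Y / u s Y)) psi
    (fun s Y HY => continuity_2d_pt_plus _ _ s Y (C1_ct HZ s Y HY)
       (continuity_2d_pt_mult _ _ s Y (C1_cY HZ s Y HY)
          (continuity_2d_pt_mult _ _ s Y (st_v S s Y) (C1_c Hinv s Y HY)))) Hpsi).
  assert (X2 := ex_RInt_pull S I (fun s Y => gY s Y * / u s Y) psi (C1_c Hq) Hpsi).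
  apply (RInt_correct (V := R_CompleteNormedModule)) in X1, X2.
  change (RInt (fun s => gY s (Yv s psi) * / u s (Yv s psi)) 0 (2 * PI))
    with (theta_integral (fun s z => gY s (Yv s z) / u s (Yv s z)) psi) in X2.
  rewrite (HA psi Hpsi) in X2.
  unfold theta_integral in M; rewrite M in X1; [| | exact Hpsi].
  2: { intros Y HY s; simpl; rewrite (fl_gper Fl Y s), (st_per S Y s); reflexivity. }
  apply is_RInt_unique.
  apply (is_RInt_scal (V := R_NormedModule) _ _ _ 2) in X1.
  apply (is_RInt_scal (V := R_NormedModule) _ _ _ (2 * e)) in X2.
  assert (X := is_RInt_minus (V := R_NormedModule) _ _ _ _ _ _ X1 X2).
  unfold minus, plus, opp, scal in X; simpl in X; unfold mult in X; simpl in X.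
  replace (2 * 0 + - (2 * e * 0)) with 0 in X by ring.
  refine (is_RInt_ext _ _ _ _ _ _ X); intros s _.
  assert (HY := Yv_neg S I s psi Hpsi).
  assert (Ei := fl_ind Fl s _ HY); assert (Em := fl_mom Fl s _ HY); assert (Eh := fl_h Fl s _ HY).
  assert (N := u_neq_0 S s (Yv s psi)).
  set (Y := Yv s psi) in *.
  eq_R; simpl.
  assert (EYY : gYY s Y = u s Y * (gt s Y
    + (- ut s Y * g s Y / u s Y + v s Y * gY s Y / u s Y
       - v s Y * g s Y * uY s Y / u s Y ^ 2) + gY s Y * uY s Y / u s Y ^ 2)).
  { replace (gt s Y + (- ut s Y * g s Y / u s Y + v s Y * gY s Y / u s Y
       - v s Y * g s Y * uY s Y / u s Y ^ 2)) with (gYY s Y / u s Y - gY s Y * uY s Y / u s Y ^ 2)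
     by lra. field; exact N. }
  assert (EuYY : kappa * uYY s Y = u s Y * ut s Y + v s Y * uY s Y - g s Y * gt s Y
     - ((v s Y * g s Y - gY s Y) / u s Y + e) * gY s Y) by (rewrite <- Eh; lra).
  replace (0 * uY s Y + kappa * uYY s Y) with (kappa * uYY s Y) by ring.
  rewrite EuYY, EYY; field; exact N.
- exact HL.
Qed.

(** * Weighted square integrability gives uniform decay *)

(** Cauchy criterion for the convergent integral, on the unit intervals to which
    point_le_RInt is applied in the proof of uniform_decay. *)
Lemma RInt_gen_tail (phi : R -> R) :
  ex_RInt_gen phi (Rbar_locally m_infty) (at_left 0) ->
  forall eps, 0 < eps -> exists M, forall Y, Y < M ->
    ex_RInt phi (Y - 1) Y /\ RInt phi (Y - 1) Y < eps.
Proof.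
intros [L HL] eps Heps.
assert (H2 : 0 < eps / 2) by lra.
destruct (HL (ball L (mkposreal _ H2)) (locally_ball L (mkposreal _ H2)))
  as [Q P [M HM] HP HQP].
(* One right end [b] is used for both integrals and cancels in their difference. *)
destruct (filter_ex P HP) as [b Hb].
exists M; intros Y HY.
destruct (HQP Y b (HM Y HY) Hb) as [I1 [HI1 B1]].
assert (HY' : Y - 1 < M) by lra.
destruct (HQP (Y - 1) b (HM _ HY') Hb) as [I2 [HI2 B2]].
simpl in HI1, HI2.
assert (H := is_RInt_Chasles (V := R_NormedModule) _ _ _ _ _ _ HI2
               (is_RInt_swap (V := R_NormedModule) _ _ _ _ HI1)).
split; [eexists; exact H |].
rewrite (is_RInt_unique _ _ _ _ H).
change (Rabs (I1 - L) < eps / 2) in B1; change (Rabs (I2 - L) < eps / 2) in B2.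
apply Rabs_def2 in B1; apply Rabs_def2 in B2.
change (I2 + - I1 < eps); lra.
Qed.

Lemma RInt_le_interval (phi : R -> R) (p s t q : R) :
  p <= s -> s <= t -> t <= q -> ex_RInt phi p q ->
  (forall x, p <= x <= q -> 0 <= phi x) ->
  ex_RInt phi s t /\ RInt phi s t <= RInt phi p q.
Proof.
intros Hps Hst Htq Hex H0.
assert (Hpt : ex_RInt phi p t)
  by (apply (ex_RInt_Chasles_1 (V := R_CompleteNormedModule) phi p t q); auto; lra).
assert (Htq' : ex_RInt phi t q)
  by (apply (ex_RInt_Chasles_2 (V := R_CompleteNormedModule) phi p t q); auto; lra).
assert (Hps' : ex_RInt phi p s)
  by (apply (ex_RInt_Chasles_1 (V := R_CompleteNormedModule) phi p s t); auto; lra).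
assert (Hst' : ex_RInt phi s t)
  by (apply (ex_RInt_Chasles_2 (V := R_CompleteNormedModule) phi p s t); auto; lra).
split; [exact Hst' |].
rewrite <- (RInt_Chasles (V := R_CompleteNormedModule) phi p t q) by auto.
rewrite <- (RInt_Chasles (V := R_CompleteNormedModule) phi p s t) by auto.
assert (0 <= RInt phi p s) by (apply RInt_ge_0; auto; intros; apply H0; lra).
assert (0 <= RInt phi t q) by (apply RInt_ge_0; auto; intros; apply H0; lra).
unfold plus; simpl; lra.
Qed.

(** One-dimensional Sobolev inequality: [f x] exceeds [f s] by at most the integral of [|f'|],
    and averaging over [s] leaves the mean of [f]. *)
Lemma point_le_RInt (f df phi : R -> R) (p q x : R) :
  p < q -> p <= x <= q ->
  (forall y, p <= y <= q -> is_derive f y (df y)) ->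
  (forall y, p <= y <= q -> continuous df y) ->
  (forall y, p <= y <= q -> f y <= phi y /\ Rabs (df y) <= phi y) ->
  ex_RInt phi p q ->
  f x <= (1 + / (q - p)) * RInt phi p q.
Proof.
intros Hpq Hx Hd Hc Hb Hex.
assert (H0 : forall y, p <= y <= q -> 0 <= phi y).
{ intros y Hy; destruct (Hb y Hy) as [_ H]; eapply Rle_trans; [apply Rabs_pos | exact H]. }
assert (FTC : forall s t, p <= s -> s <= t -> t <= q ->
          is_RInt df s t (f t - f s)).
{ intros s t Hs Hst Ht.
  apply (is_RInt_derive (V := R_CompleteNormedModule) f df);
  intros y; rewrite Rmin_left, Rmax_right by lra; intros Hy; [apply Hd | apply Hc]; lra. }
assert (Osc : forall s t, p <= s -> s <= t -> t <= q ->
          Rabs (f t - f s) <= RInt phi p q).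
{ intros s t Hs Hst Ht.
  destruct (RInt_le_interval phi p s t q Hs Hst Ht Hex H0) as [Est Hle].
  assert (F := FTC s t Hs Hst Ht).
  eapply Rle_trans; [| exact Hle].
  apply (norm_RInt_le (V := R_NormedModule) df phi s t); auto.
  - intros y Hy; apply Hb; lra.
  - apply (RInt_correct (V := R_CompleteNormedModule)), Est. }
assert (Osc' : forall s, p <= s <= q -> f x <= f s + RInt phi p q).
{ intros s Hs; destruct (Rle_dec s x) as [H | H].
  - assert (G := Osc s x ltac:(lra) H ltac:(lra)).
    apply Rabs_le_between in G; lra.
  - assert (G := Osc x s ltac:(lra) ltac:(lra) ltac:(lra)).
    apply Rabs_le_between in G; lra. }
assert (Hf : ex_RInt f p q).
{ apply (ex_RInt_continuous (V := R_CompleteNormedModule)); intros y.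
  rewrite Rmin_left, Rmax_right by lra; intros Hy.
  apply (ex_derive_continuous (V := R_NormedModule)); eexists; apply Hd, Hy. }
assert (Hint : RInt (fun _ => f x) p q <= RInt (fun s => plus (f s) (RInt phi p q)) p q).
{ apply RInt_le; [lra | apply ex_RInt_const | | intros s Hs; apply Osc'; lra].
  apply (ex_RInt_plus (V := R_NormedModule)); [exact Hf | apply ex_RInt_const]. }
rewrite (RInt_plus (V := R_CompleteNormedModule)) in Hint; [| exact Hf | apply ex_RInt_const].
rewrite !RInt_const in Hint.
unfold plus, scal in Hint; simpl in Hint; unfold mult in Hint; simpl in Hint.
assert (Hle : RInt f p q <= RInt phi p q).
{ apply RInt_le; auto; [lra | intros y Hy; apply Hb; lra]. }
apply Rmult_le_reg_l with (q - p); [lra |].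
replace ((q - p) * ((1 + / (q - p)) * RInt phi p q))
  with (RInt phi p q + (q - p) * RInt phi p q) by (field; lra).
lra.
Qed.

Lemma C1_below_slice_energy w1 w1t w1Y w2 w2t w2Y p q Y :
  C1_below w1 w1t w1Y -> C1_below w2 w2t w2Y -> Y < 0 ->
  is_derive (fun z => RInt (fun s => w1 s z ^ 2 + w2 s z ^ 2) p q) Y
    (RInt (fun s => 2 * (w1 s Y * w1Y s Y + w2 s Y * w2Y s Y)) p q).
Proof.
intros H1 H2 HY.
apply (is_derive_RInt_snd (fun z => z < 0) (fun s z => w1 s z ^ 2 + w2 s z ^ 2)
         (fun s z => 2 * (w1 s z * w1Y s z + w2 s z * w2Y s z))).
- apply open_lt.
- exact HY.
- intros s z Hz; auto_derive.
  + repeat split; eexists; [apply (C1_dY H1) | apply (C1_dY H2)]; auto.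
  + assert (E1 := is_derive_unique _ _ _ (C1_dY H1 s z Hz)).
    assert (E2 := is_derive_unique _ _ _ (C1_dY H2 s z Hz)).
    simpl in E1, E2 |- *; rewrite E1, E2; ring.
- intros s z Hz.
  apply (continuity_2d_pt_ext (fun s z => w1 s z * w1 s z + w2 s z * w2 s z)); [intros; ring |].
  apply continuity_2d_pt_plus; apply continuity_2d_pt_mult; eauto using C1_c.
- intros s z Hz.
  apply continuity_2d_pt_mult; [apply continuity_2d_pt_const |].
  apply continuity_2d_pt_plus; apply continuity_2d_pt_mult; eauto using C1_c, C1_cY.
Qed.

(** The slice energy [E Y], the integral over [theta] of [w^2 + w_theta^2], and its derivative
    are both bounded by the integrable function [phi].  Thus [E Y] is at most twice the
    integral of [phi] over [[Y - 1, Y]], which tends to zero, and in turn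
    [E] controls [w^2] pointwise on the slice. *)
Lemma uniform_decay w wt wY wtt wtY phi :
  C1_below w wt wY -> C1_below wt wtt wtY ->
  (forall Y, Y < 0 ->
     RInt (fun s => w s Y ^ 2 + wt s Y ^ 2 + wY s Y ^ 2 + wtY s Y ^ 2) 0 (2 * PI) <= phi Y) ->
  ex_RInt_gen phi (Rbar_locally m_infty) (at_left 0) ->
  forall eps, 0 < eps -> exists M, forall s Y, 0 <= s <= 2 * PI -> Y < M ->
    Rabs (w s Y) < eps.
Proof.
intros Hw Hwt Hphi Hex eps Heps.
assert (HPI := PI2_1).
assert (He : 0 < eps ^ 2 / 4) by (apply Rdiv_lt_0_compat; [apply pow_lt, Heps | lra]).
destruct (RInt_gen_tail phi Hex _ He) as [M HM].
exists (Rmin M 0); intros s Y Hs HY.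
assert (HY0 : Y < 0) by (eapply Rlt_le_trans; [exact HY | apply Rmin_r]).
assert (HYM : Y < M) by (eapply Rlt_le_trans; [exact HY | apply Rmin_l]).
destruct (HM Y HYM) as [Exi Hint].
assert (Csq : forall f : R -> R -> R, (forall s Y, Y < 0 -> continuity_2d_pt f s Y) ->
          forall s Y, Y < 0 -> continuity_2d_pt (fun s Y => f s Y ^ 2) s Y).
{ intros f Hf t z Hz; apply (continuity_2d_pt_ext (fun s Y => f s Y * f s Y)); [intros; ring |].
  apply continuity_2d_pt_mult; auto. }
assert (C0 := Csq _ (C1_c Hw)); assert (C1 := Csq _ (C1_c Hwt)).
assert (C2 := Csq _ (C1_cY Hw)); assert (C3 := Csq _ (C1_cY Hwt)).
assert (C01 : forall s Y, Y < 0 -> continuity_2d_pt (fun s Y => w s Y ^ 2 + wt s Y ^ 2) s Y)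
  by (intros; apply continuity_2d_pt_plus; auto).
assert (C4 : forall s Y, Y < 0 -> continuity_2d_pt
   (fun s Y => w s Y ^ 2 + wt s Y ^ 2 + wY s Y ^ 2 + wtY s Y ^ 2) s Y)
  by (intros; repeat apply continuity_2d_pt_plus; auto).
set (E := fun z => RInt (fun s => w s z ^ 2 + wt s z ^ 2) 0 (2 * PI)).
set (dE := fun z => RInt (fun s => 2 * (w s z * wY s z + wt s z * wtY s z)) 0 (2 * PI)).
assert (CdE : forall s z, z < 0 -> continuity_2d_pt
   (fun s z => 2 * (w s z * wY s z + wt s z * wtY s z)) s z).
{ intros t z Hz; apply continuity_2d_pt_mult; [apply continuity_2d_pt_const |].
  apply continuity_2d_pt_plus; apply continuity_2d_pt_mult; eauto using C1_c, C1_cY. }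
assert (HE : E Y < eps ^ 2 / 2).
{ assert (H : E Y <= (1 + / (Y - (Y - 1))) * RInt phi (Y - 1) Y).
  { apply (point_le_RInt E dE); try lra; auto.
    - intros z Hz; assert (Hz0 : z < 0) by lra.
      exact (C1_below_slice_energy _ _ _ _ _ _ 0 (2 * PI) z Hw Hwt Hz0).
    - intros z Hz; apply (continuous_RInt_snd (fun z => z < 0)); auto; [apply open_lt | lra].
    - intros z Hz; assert (Hz0 : z < 0) by lra; split.
      + eapply Rle_trans; [| apply Hphi, Hz0].
        apply RInt_le; [lra | | | intros t _; nra];
        [apply (ex_RInt_fst (fun s Y => w s Y ^ 2 + wt s Y ^ 2))
        |apply (ex_RInt_fst (fun s Y => w s Y ^ 2 + wt s Y ^ 2 + wY s Y ^ 2 + wtY s Y ^ 2))]; auto.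
      + eapply Rle_trans; [| apply Hphi, Hz0].
        apply (norm_RInt_le (V := R_NormedModule)
          (fun s => 2 * (w s z * wY s z + wt s z * wtY s z))
          (fun s => w s z ^ 2 + wt s z ^ 2 + wY s z ^ 2 + wtY s z ^ 2) 0 (2 * PI)); [lra | | |].
        * intros t _; apply Rabs_le.
          assert (Q1 := pow2_ge_0 (w t z - wY t z)); assert (Q2 := pow2_ge_0 (w t z + wY t z)).
          assert (Q3 := pow2_ge_0 (wt t z - wtY t z)); assert (Q4 := pow2_ge_0 (wt t z + wtY t z)).
          lra.
        * apply (RInt_correct (V := R_CompleteNormedModule)).
          apply (ex_RInt_fst (fun s z => 2 * (w s z * wY s z + wt s z * wtY s z))); auto.
        * apply (RInt_correct (V := R_CompleteNormedModule)).
          apply (ex_RInt_fst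
            (fun s Y => w s Y ^ 2 + wt s Y ^ 2 + wY s Y ^ 2 + wtY s Y ^ 2)); auto. }
  replace (1 + / (Y - (Y - 1))) with 2 in H by (field; lra). lra. }
(* The same inequality in [theta]; a period is longer than 1. *)
assert (Hp : w s Y ^ 2 <= (1 + / (2 * PI - 0)) * E Y).
{ apply (point_le_RInt (fun t => w t Y ^ 2) (fun t => 2 * (w t Y * wt t Y))
           (fun t => w t Y ^ 2 + wt t Y ^ 2)); try lra; auto.
  - intros t _; apply (is_derive_ext (fun t => w t Y * w t Y)); [intros; eq_R; ring |].
    evar_last; [apply (is_derive_mult (fun t => w t Y) (fun t => w t Y));
      [apply (C1_dt Hw); auto .. | exact Rmult_comm] |].
    eq_R; unfold plus, mult; simpl; ring.
  - intros t _; apply (continuity_2d_pt_fst (fun t z => 2 * (w t z * wt t z))).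
    apply continuity_2d_pt_mult; [apply continuity_2d_pt_const |].
    apply continuity_2d_pt_mult; eauto using C1_c.
  - intros t _; split; [nra | apply Rabs_le].
    assert (Q1 := pow2_ge_0 (w t Y - wt t Y)); assert (Q2 := pow2_ge_0 (w t Y + wt t Y)).
    lra.
  - apply (ex_RInt_fst (fun t z => w t z ^ 2 + wt t z ^ 2)); auto. }
assert (H1 : / (2 * PI - 0) <= 1).
{ rewrite <- Rinv_1; apply Rinv_le_contravar; lra. }
assert (H2 : 0 < / (2 * PI - 0)) by (apply Rinv_0_lt_compat; lra).
assert (H3 : w s Y ^ 2 < eps ^ 2) by nra.
apply Rabs_lt_between; split; nra.
Qed.

(** * Far field *)

(** One period of [theta] is enough, since only integrals over it are taken. *)
Definition far_uniform (w : R -> R -> R) (L : R) : Prop :=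
  forall eps, 0 < eps -> exists M, forall s Y, 0 <= s <= 2 * PI -> Y < M ->
    Rabs (w s Y - L) < eps.

(** Streamlines go to minus infinity uniformly: the one through [(theta, Y)] with [Y >= M] has
    [psi] at least the minimum over [theta] of the stream function on [Y = M]. *)
Lemma Yv_far {c u v ut uY Yv} (S : stream c u v ut uY) (I : right_inverse u Yv) M :
  exists N, forall s psi, 0 <= s <= 2 * PI -> psi < N -> Yv s psi < M.
Proof.
assert (HPI := PI_RGT_0).
destruct (continuity_ab_min (fun s => von_Mises u s M) 0 (2 * PI)) as [s0 [Hmin _]]; [lra | |].
- intros s _; apply continuity_pt_filterlim, (continuous_von_Mises_fst S).
- exists (von_Mises u s0 M); intros s psi Hs Hpsi.
  destruct (Rlt_le_dec (Yv s psi) M) as [| H]; auto; exfalso.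
  assert (E := von_Mises_diff S s M (Yv s psi)).
  assert (G := mean_u_ge S s M (Yv s psi)).
  assert (Hc := st_c S); rewrite I in E.
  specialize (Hmin s Hs); nra.
Qed.

Lemma theta_integral_far {c u v ut uY Yv} (S : stream c u v ut uY) (I : right_inverse u Yv) w L :
  (forall s Y, continuity_2d_pt w s Y) -> far_uniform w L ->
  is_lim (theta_integral (fun s z => w s (Yv s z))) m_infty (2 * PI * L).
Proof.
intros Hw HL; apply is_lim_spec; intros [eps Heps]; simpl.
assert (HPI := PI_RGT_0).
assert (He : 0 < eps / (4 * PI)) by (apply Rdiv_lt_0_compat; lra).
destruct (HL _ He) as [M HM]; destruct (Yv_far S I M) as [N HN].
exists N; intros psi Hpsi.
assert (Hex : forall k, is_RInt (fun s => w s (Yv s psi) - k) 0 (2 * PI)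
          (theta_integral (fun s z => w s (Yv s z)) psi - 2 * PI * k)).
{ intros k; apply (is_RInt_minus (V := R_NormedModule)).
  - apply (RInt_correct (V := R_CompleteNormedModule)).
    apply (ex_RInt_fst (fun s z => w s (Yv s z))); intros s; apply (continuity_pull S I), Hw.
  - replace (2 * PI * k) with (scal (2 * PI - 0) k)
      by (unfold scal; simpl; unfold mult; simpl; ring).
    apply (is_RInt_const (V := R_NormedModule)). }
assert (H := norm_RInt_le_const (V := R_NormedModule) _ 0 (2 * PI) _ (eps / (4 * PI))
  ltac:(lra) (fun s Hs => Rlt_le _ _ (HM s _ Hs (HN s psi Hs Hpsi))) (Hex L)).
eapply Rle_lt_trans; [exact H |].
replace ((2 * PI - 0) * (eps / (4 * PI))) with (eps / 2) by (field; lra); lra.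
Qed.

Lemma flow_integrals {kappa e c u v g h ut uY uYt uYY gt gY gYt gYY}
  (Fl : flow kappa e c u v g h ut uY uYt uYY gt gY gYt gYY) {Yv}
  (I : right_inverse u Yv) (a b : R) :
  far_uniform u a -> far_uniform g b ->
  (forall psi, psi <= 0 -> theta_integral (fun s z => g s (Yv s z)) psi = 2 * PI * b) /\
  (forall psi, psi <= 0 ->
     theta_integral (fun s z => kappa * u s (Yv s z) ^ 2 - g s (Yv s z) ^ 2) psi
     = 2 * PI * (kappa * a ^ 2 - b ^ 2)).
Proof.
intros Ha Hb; assert (S := fl_st Fl).
destruct (conserved_field Fl I (2 * PI * b)) as [H0 HG].
{ apply (theta_integral_far S I g); [apply (fl_gc Fl) | exact Hb]. }
split; [exact HG |].
apply (conserved_momentum Fl I (2 * PI * (kappa * a ^ 2 - b ^ 2)) H0).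
set (K := fun x y => kappa * x ^ 2 - y ^ 2).
assert (CK : forall x y, continuity_2d_pt K x y).
{ intros x y; apply (continuity_2d_pt_ext (fun x y => kappa * (x * x) - y * y));
    [intros; unfold K; ring |].
  apply continuity_2d_pt_minus; apply continuity_2d_pt_mult;
  try apply continuity_2d_pt_const; try apply continuity_2d_pt_id2.
  apply continuity_2d_pt_mult; apply continuity_2d_pt_id1. }
apply (theta_integral_far S I (fun s Y => K (u s Y) (g s Y))).
- intros s Y; apply (continuity_2d_pt_comp K u g); [apply CK | apply (st_u S) | apply (fl_gc Fl)].
- intros eps Heps; destruct (CK a b (mkposreal _ Heps)) as [d Hd].
  destruct (Ha d (cond_pos d)) as [M1 H1]; destruct (Hb d (cond_pos d)) as [M2 H2].
  exists (Rmin M1 M2); intros s Y Hs HY; apply Hd.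
  + apply H1; auto; eapply Rlt_le_trans; [exact HY | apply Rmin_l].
  + apply H2; auto; eapply Rlt_le_trans; [exact HY | apply Rmin_r].
Qed.

(** Constant extension above the boundary.  It makes a function that is continuous up to the
    boundary continuous on the whole plane, and changes nothing for [Y <= 0]. *)
Definition clamp (w : R -> R -> R) (s Y : R) : R := w s (Rmin Y 0).

Lemma clamp_below w s Y : Y <= 0 -> clamp w s Y = w s Y.
Proof. intros H; unfold clamp; rewrite Rmin_left; auto. Qed.

Lemma continuity_clamp w :
  continuous_on (fun p : R * R => snd p <= 0) (fun p => w (fst p) (snd p)) ->
  forall s Y, continuity_2d_pt (clamp w) s Y.
Proof.
intros H s Y; apply continuity_2d_pt_filterlim.
intros P HP; destruct (H (s, Rmin Y 0) (Rmin_r Y 0) P HP) as [d Hd].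
exists d; intros [s' Y'] [Hs HY]; apply (Hd (s', Rmin Y' 0)); [split |]; simpl in *.
- exact Hs.
- change (Rabs (Y' - Y) < d) in HY; change (Rabs (Rmin Y' 0 - Rmin Y 0) < d).
  eapply Rle_lt_trans; [| exact HY].
  unfold Rmin; destruct (Rle_dec Y' 0), (Rle_dec Y 0);
  unfold Rabs; repeat destruct Rcase_abs; lra.
- apply Rmin_r.
Qed.

Lemma C1_below_clamp w wt wY : C1_below w wt wY -> C1_below (clamp w) wt wY.
Proof.
apply C1_below_ext; auto; intros; symmetry; apply clamp_below; lra.
Qed.

Lemma C2_interior_C1 w : C2_interior w -> C1_below w (d_theta w) (d_Y w).
Proof.
intros H; split; intros s Y HY; destruct (H s Y HY) as [Hc [Ht [HYd [Hct HcY]]]].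
- apply Derive_correct, Ht.
- apply Derive_correct, HYd.
- exact Hc.
- apply Hct.
- apply HcY.
Qed.

Lemma C2_interior_C1_dY w :
  C2_interior w -> C1_below (d_Y w) (d_theta (d_Y w)) (d_Y (d_Y w)).
Proof.
intros H; split; intros s Y HY; destruct (H s Y HY) as [_ [_ [_ [_ [Hc [Ht [HYd [Hct HcY]]]]]]]].
- apply Derive_correct, Ht.
- apply Derive_correct, HYd.
- exact Hc.
- apply Hct.
- apply HcY.
Qed.

(** The [Y]-derivative of [w_theta] is identified with the mixed derivative that occurs in
    the weighted norm, where [Y] is differentiated first. *)
Lemma C2_interior_C1_dtheta w :
  C2_interior w -> C1_below (d_theta w) (d_theta (d_theta w)) (partial_derive 1 1 w).
Proof.
intros H.
apply (C1_below_ext (d_theta w) (d_theta (d_theta w)) (d_Y (d_theta w))); auto.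
- intros s Y HY; apply (Derive_partial_derive 1 0 w s Y).
  apply locally_2d_below; auto.
- split; intros s Y HY; destruct (H s Y HY) as [_ [_ [_ [[Hc [Ht [HYd [Hct HcY]]]] _]]]].
  + apply Derive_correct, Ht.
  + apply Derive_correct, HYd.
  + exact Hc.
  + apply Hct.
  + apply HcY.
Qed.

Lemma continuity_partial_derive w j k s Y :
  C2_interior w -> (j + k <= 2)%nat -> Y < 0 -> continuity_2d_pt (partial_derive j k w) s Y.
Proof.
intros H Hjk HY.
assert (E := ex_diff_n_deriv 2 j k Hjk w s Y (H s Y HY)).
destruct (2 - (j + k))%nat; apply E.
Qed.

Lemma weight_ge_1 l Y : 0 <= l -> 1 <= Rpower (japanese Y) (2 * l).
Proof.
intros Hl; unfold Rpower.
assert (HJ : 1 <= japanese Y).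
{ unfold japanese; rewrite <- sqrt_1 at 1; apply sqrt_le_1_alt.
  assert (P := pow2_ge_0 Y); lra. }
assert (0 <= ln (japanese Y)).
{ rewrite <- ln_1; apply ln_le; lra. }
eapply Rle_trans; [| apply exp_ineq1_le]; nra.
Qed.

Lemma weighted_slice_ge l j k w1 w2 w3 w4 w Y :
  0 <= l -> (j + k <= 2)%nat -> Y < 0 ->
  C2_interior w1 -> C2_interior w2 -> C2_interior w3 -> C2_interior w4 -> C2_interior w ->
  (forall s, partial_derive j k w s Y ^ 2 <=
     partial_derive j k w1 s Y ^ 2 + partial_derive j k w2 s Y ^ 2
     + partial_derive j k w3 s Y ^ 2 + partial_derive j k w4 s Y ^ 2) ->
  RInt (fun s => partial_derive j k w s Y ^ 2) 0 (2 * PI)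
    <= weighted_slice l j k w1 w2 w3 w4 Y.
Proof.
intros Hl Hjk HY H1 H2 H3 H4 H Hle.
assert (HPI := PI_RGT_0).
assert (Hsq : forall f, C2_interior f -> forall s,
          continuous (fun s => partial_derive j k f s Y ^ 2) s).
{ intros f Hf s.
  assert (Hc := continuity_2d_pt_fst _ _ _ (continuity_partial_derive f j k s Y Hf Hjk HY)).
  apply (continuous_ext (fun s => partial_derive j k f s Y * partial_derive j k f s Y));
    [intros; eq_R; ring |].
  apply (continuous_mult (K := R_AbsRing)); exact Hc. }
apply RInt_le; [lra | | |].
- apply (ex_RInt_continuous (V := R_CompleteNormedModule)); intros s _; apply Hsq, H.
- apply (ex_RInt_continuous (V := R_CompleteNormedModule)); intros s _.
  apply (continuous_mult (K := R_AbsRing)); [| apply continuous_const].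
  exact (continuous_plus (V := R_NormedModule) _ _ _
    (continuous_plus (V := R_NormedModule) _ _ _
      (continuous_plus (V := R_NormedModule) _ _ _ (Hsq w1 H1 s) (Hsq w2 H2 s))
      (Hsq w3 H3 s)) (Hsq w4 H4 s)).
- intros s _.
  assert (W := weight_ge_1 l Y Hl).
  assert (P := pow2_ge_0 (partial_derive j k w s Y)).
  specialize (Hle s); nra.
Qed.

(** The hypothesis on partial derivatives says that the deviation [w - L] is dominated by the four
    functions of the weighted norm, as it is when it is one of them.  The weight is at
    least one, so it can be dropped. *)
Lemma weighted_far_uniform l M w1 w2 w3 w4 w L :
  0 <= l -> weighted_H2_bound l M w1 w2 w3 w4 ->
  C2_interior (fun s Y => w s Y - L) ->
  (forall j k s Y, partial_derive j k (fun s Y => w s Y - L) s Y ^ 2 <=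
     partial_derive j k w1 s Y ^ 2 + partial_derive j k w2 s Y ^ 2
     + partial_derive j k w3 s Y ^ 2 + partial_derive j k w4 s Y ^ 2) ->
  far_uniform w L.
Proof.
intros Hl [H1 [H2 [H3 [H4 [Hex _]]]]] H Hle.
set (f := fun s Y => w s Y - L) in *.
set (ws := fun j k => weighted_slice l j k w1 w2 w3 w4).
assert (Hge : forall j k Y, (j + k <= 2)%nat -> Y < 0 ->
          RInt (fun s => partial_derive j k f s Y ^ 2) 0 (2 * PI) <= ws j k Y).
{ intros j k Y Hjk HY.
  exact (weighted_slice_ge l j k w1 w2 w3 w4 f Y Hl Hjk HY H1 H2 H3 H4 H (fun s => Hle j k s Y)). }
assert (Hsq : forall j k Y, (j + k <= 2)%nat -> Y < 0 ->
          ex_RInt (fun s => partial_derive j k f s Y ^ 2) 0 (2 * PI)).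
{ intros j k Y Hjk HY; apply (ex_RInt_continuous (V := R_CompleteNormedModule)); intros s _.
  assert (Hc := continuity_2d_pt_fst _ _ _ (continuity_partial_derive f j k s Y H Hjk HY)).
  apply (continuous_ext (fun s => partial_derive j k f s Y * partial_derive j k f s Y));
    [intros; eq_R; ring |].
  apply (continuous_mult (K := R_AbsRing)); exact Hc. }
refine (uniform_decay f (d_theta f) (d_Y f) (d_theta (d_theta f)) (partial_derive 1 1 f)
  (fun Y => plus (plus (plus (ws 0%nat 0%nat Y) (ws 1%nat 0%nat Y)) (ws 0%nat 1%nat Y))
              (ws 1%nat 1%nat Y)) _ _ _ _).
- apply C2_interior_C1, H.
- apply C2_interior_C1_dtheta, H.
- intros Y HY.
  assert (G00 := Hge 0%nat 0%nat Y ltac:(lia) HY); assert (G10 := Hge 1%nat 0%nat Y ltac:(lia) HY).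
  assert (G01 := Hge 0%nat 1%nat Y ltac:(lia) HY); assert (G11 := Hge 1%nat 1%nat Y ltac:(lia) HY).
  assert (S00 := Hsq 0%nat 0%nat Y ltac:(lia) HY); assert (S10 := Hsq 1%nat 0%nat Y ltac:(lia) HY).
  assert (S01 := Hsq 0%nat 1%nat Y ltac:(lia) HY); assert (S11 := Hsq 1%nat 1%nat Y ltac:(lia) HY).
  apply (RInt_correct (V := R_CompleteNormedModule)) in S00, S10, S01, S11.
  assert (X := is_RInt_plus (V := R_NormedModule) _ _ _ _ _ _
    (is_RInt_plus (V := R_NormedModule) _ _ _ _ _ _
      (is_RInt_plus (V := R_NormedModule) _ _ _ _ _ _ S00 S10) S01) S11).
  change (is_RInt (fun s => f s Y ^ 2 + d_theta f s Y ^ 2 + d_Y f s Y ^ 2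
    + partial_derive 1 1 f s Y ^ 2) 0 (2 * PI)
    (RInt (fun s => partial_derive 0 0 f s Y ^ 2) 0 (2 * PI)
     + RInt (fun s => partial_derive 1 0 f s Y ^ 2) 0 (2 * PI)
     + RInt (fun s => partial_derive 0 1 f s Y ^ 2) 0 (2 * PI)
     + RInt (fun s => partial_derive 1 1 f s Y ^ 2) 0 (2 * PI))) in X.
  rewrite (is_RInt_unique _ _ _ _ X).
  match goal with |- ?x <= _ =>
    change (x <= ws 0%nat 0%nat Y + ws 1%nat 0%nat Y + ws 0%nat 1%nat Y + ws 1%nat 1%nat Y)
  end.
  lra.
- destruct (Hex 0%nat 0%nat ltac:(lia)) as [I00 X00], (Hex 1%nat 0%nat ltac:(lia)) as [I10 X10].
  destruct (Hex 0%nat 1%nat ltac:(lia)) as [I01 X01], (Hex 1%nat 1%nat ltac:(lia)) as [I11 X11].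
  eexists.
  exact (is_RInt_gen_plus (V := R_NormedModule) _ _ _ _
    (is_RInt_gen_plus (V := R_NormedModule) _ _ _ _
      (is_RInt_gen_plus (V := R_NormedModule) _ _ _ _ X00 X10) X01) X11).
Qed.

(** * The oriented problem *)

Lemma constant_zero_second_derivative A :
  constant_on_half_line A -> zero_second_derivative A.
Proof.
intros H.
assert (D : forall p, p < 0 -> is_derive A p 0).
{ intros p Hp; apply (is_derive_ext_loc (fun _ => A 0)).
  - apply (filter_imp (fun z => z < 0)); [intros; apply H; lra | apply open_lt, Hp].
  - apply (is_derive_const (K := R_AbsRing) (V := R_NormedModule)). }
intros p Hp; split; [exists 0; apply D, Hp |].
apply (is_derive_ext_loc (fun _ => 0)).
- apply (filter_imp (fun z => z < 0)); [| apply open_lt, Hp].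
  intros z Hz; symmetry; apply is_derive_unique, D, Hz.
- apply (is_derive_const (K := R_AbsRing) (V := R_NormedModule)).
Qed.

Lemma oriented_flow kappa uw gw u v g h c :
  regular u -> regular v -> regular g ->
  (forall Y, Y <= 0 ->
     periodic (fun theta => u theta Y) /\ periodic (fun theta => v theta Y) /\
     periodic (fun theta => g theta Y) /\ periodic (fun theta => h theta Y)) ->
  MHD_Prandtl kappa uw gw u v g h -> induction_relation u v g h ->
  0 < c -> (forall theta Y, Y <= 0 -> c <= u theta Y) ->
  exists e, flow kappa e c (clamp u) (clamp v) (clamp g) h
    (d_theta u) (d_Y u) (d_theta (d_Y u)) (d_Y (d_Y u))
    (d_theta g) (d_Y g) (d_theta (d_Y g)) (d_Y (d_Y g)).
Proof.
intros [Ru Cu] [Rv Cv] [Rg Cg] Hper [Emom [Eind [Ediv [_ [Ebd _]]]]] [e Eh] Hc Hge.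
assert (Hu := C2_interior_C1 u Ru); assert (Hv := C2_interior_C1 v Rv).
assert (Hg := C2_interior_C1 g Rg); assert (HgY := C2_interior_C1_dY g Rg).
assert (Hcl : forall w s Y, Y < 0 -> clamp w s Y = w s Y)
  by (intros; apply clamp_below; lra).
exists e; split.
- split.
  + exact Hc.
  + intros s Y; apply Hge, Rmin_r.
  + apply continuity_clamp, Cu.
  + apply continuity_clamp, Cv.
  + intros s; rewrite clamp_below by lra; apply Ebd.
  + intros Y; apply (Hper (Rmin Y 0) (Rmin_r Y 0)).
  + apply C1_below_clamp, Hu.
  + intros s Y HY; replace (- d_theta u s Y) with (d_Y v s Y) by (assert (H := Ediv s Y HY); lra).
    apply (C1_dY (C1_below_clamp _ _ _ Hv)), HY.
- apply C2_interior_C1_dY, Ru.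
- apply C1_below_clamp, Hg.
- exact HgY.
- apply continuity_clamp, Cg.
- intros Y; apply (Hper (Rmin Y 0) (Rmin_r Y 0)).
- intros s Y HY; rewrite !Hcl by exact HY; apply Emom, HY.
- intros s Y HY; rewrite !Hcl by exact HY.
  assert (N : u s Y <> 0) by (assert (H := Hge s Y ltac:(lra)); lra).
  assert (Dv := C1_dY Hv s Y HY); assert (Du := C1_dY Hu s Y HY).
  assert (Dg := C1_dY Hg s Y HY); assert (DgY := C1_dY HgY s Y HY).
  rewrite <- (Eind s Y HY).
  assert (E1 : d_Y (fun t z => v t z * g t z / u t z) s Y
      = ((d_Y v s Y * g s Y + v s Y * d_Y g s Y) * u s Y - v s Y * g s Y * d_Y u s Y)
        / u s Y ^ 2).
  { apply is_derive_unique.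
    apply (is_derive_div (fun z => v s z * g s z) (fun z => u s z)); auto.
    apply (is_derive_mult (fun z => v s z) (fun z => g s z)); auto; exact Rmult_comm. }
  assert (E2 : d_Y (fun t z => d_Y g t z / u t z) s Y
      = (d_Y (d_Y g) s Y * u s Y - d_Y g s Y * d_Y u s Y) / u s Y ^ 2).
  { apply is_derive_unique.
    apply (is_derive_div (fun z => d_Y g s z) (fun z => u s z)); auto. }
  rewrite E1, E2.
  replace (d_theta u s Y) with (- d_Y v s Y) by (assert (H := Ediv s Y HY); lra).
  field; exact N.
- intros s Y HY; rewrite !Hcl by exact HY; apply Eh, HY.
Qed.

Lemma RInt_affine_zero_mean (f : R -> R) (k m : R) :
  (forall x, continuous f x) -> zero_mean f ->
  is_RInt (fun s => k + m * f s) 0 (2 * PI) (2 * PI * k).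
Proof.
intros Hf Hm.
assert (H : is_RInt f 0 (2 * PI) 0).
{ evar_last; [| exact Hm]; apply (RInt_correct (V := R_CompleteNormedModule)).
  apply (ex_RInt_continuous (V := R_CompleteNormedModule)); auto. }
replace (2 * PI * k) with (plus (scal (2 * PI - 0) k) (scal m 0))
  by (unfold plus, scal; simpl; unfold mult; simpl; ring).
apply (is_RInt_plus (V := R_NormedModule)).
- apply (is_RInt_const (V := R_NormedModule)).
- apply (is_RInt_scal (V := R_NormedModule)), H.
Qed.

(** The cross terms [2 kappa alpha eta f] and [2 beta eta fh] integrate to zero. *)
Lemma boundary_energy kappa alpha beta eta (f fh : R -> R) :
  kappa <> 0 ->
  (forall x, continuous f x) -> zero_mean f -> (forall x, continuous fh x) -> zero_mean fh ->
  is_RInt (fun s => kappa * (alpha + eta * f s) ^ 2 - (beta + eta * fh s) ^ 2) 0 (2 * PI)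
    (2 * PI * (kappa * alpha ^ 2 - beta ^ 2)
     + kappa * eta ^ 2 * RInt (fun s => f s ^ 2 - / kappa * fh s ^ 2) 0 (2 * PI)).
Proof.
intros Hk Cf Mf Cfh Mfh.
assert (Csq : forall p : R -> R, (forall x, continuous p x) ->
          forall x, continuous (fun x => p x ^ 2) x).
{ intros p Hp x; apply (continuous_ext (fun x => p x * p x)); [intros; eq_R; ring |].
  apply (continuous_mult (K := R_AbsRing)); apply Hp. }
assert (X : is_RInt (fun s => f s ^ 2 - / kappa * fh s ^ 2) 0 (2 * PI)
              (RInt (fun s => f s ^ 2 - / kappa * fh s ^ 2) 0 (2 * PI))).
{ apply (RInt_correct (V := R_CompleteNormedModule)).
  apply (ex_RInt_continuous (V := R_CompleteNormedModule)); intros s _.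
  apply (continuous_minus (V := R_NormedModule)); [apply Csq, Cf |].
  apply (continuous_mult (K := R_AbsRing)); [apply continuous_const | apply Csq, Cfh]. }
set (J := RInt _ _ _) in *.
assert (X1 := RInt_affine_zero_mean f (kappa * alpha ^ 2) (2 * kappa * alpha * eta) Cf Mf).
assert (X2 := RInt_affine_zero_mean fh (- beta ^ 2) (- (2 * beta * eta)) Cfh Mfh).
assert (Z := is_RInt_plus (V := R_NormedModule) _ _ _ _ _ _
  (is_RInt_plus (V := R_NormedModule) _ _ _ _ _ _ X1 X2)
  (is_RInt_scal (V := R_NormedModule) _ _ _ (kappa * eta ^ 2) _ X)).
replace (2 * PI * (kappa * alpha ^ 2 - beta ^ 2) + kappa * eta ^ 2 * J)
  with (plus (plus (2 * PI * (kappa * alpha ^ 2)) (2 * PI * - beta ^ 2))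
          (scal (kappa * eta ^ 2) J))
  by (unfold plus, scal; simpl; unfold mult; simpl; ring).
refine (is_RInt_ext _ _ _ _ _ _ Z); intros s _.
eq_R; unfold plus, scal; simpl; unfold mult; simpl; field; exact Hk.
Qed.

(** The two constants found in flow_integrals are evaluated on the boundary.  The sign of
    the far field is decided by [u >= cstar], which makes [a] positive in the limit and
    [alpha] positive as the mean of [u] over the boundary. *)
Lemma oriented_case
  (kappa alpha beta eta cstar a b l M : R) (f fh : R -> R)
  (u v g h : R -> R -> R) (vinf hinf : R -> R) :
  0 < kappa ->
  (forall x, continuous f x) -> zero_mean f ->
  (forall x, continuous fh x) -> zero_mean fh ->
  regular u -> regular v -> regular g ->
  (forall Y, Y <= 0 ->
     periodic (fun theta => u theta Y) /\ periodic (fun theta => v theta Y) /\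
     periodic (fun theta => g theta Y) /\ periodic (fun theta => h theta Y)) ->
  MHD_Prandtl kappa (fun theta => alpha + eta * f theta)
    (fun theta => beta + eta * fh theta) u v g h ->
  induction_relation u v g h ->
  0 < cstar -> (forall theta Y, Y <= 0 -> cstar <= u theta Y) ->
  0 <= l ->
  weighted_H2_bound l M
    (fun theta Y => u theta Y - a) (fun theta Y => v theta Y - vinf theta)
    (fun theta Y => g theta Y - b) (fun theta Y => h theta Y - hinf theta) ->
  exists Yv : R -> R -> R,
    von_Mises_inverse u Yv /\
    (let G := fun theta psi => g theta (Yv theta psi) in
     let K := fun theta psi =>
       kappa * (u theta (Yv theta psi)) ^ 2 - (g theta (Yv theta psi)) ^ 2 in
     theta_integrable G /\ theta_integrable K /\
     zero_second_derivative (theta_integral G) /\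
     zero_second_derivative (theta_integral K) /\
     constant_on_half_line (theta_integral G) /\
     constant_on_half_line (theta_integral K)) /\
    b = beta /\
    kappa * a ^ 2 - b ^ 2 =
      / (2 * PI) * RInt (fun theta => kappa * (alpha + eta * f theta) ^ 2
                                      - (beta + eta * fh theta) ^ 2) 0 (2 * PI) /\
    a ^ 2 = alpha ^ 2 + eta ^ 2 / (2 * PI)
              * RInt (fun theta => (f theta) ^ 2 - / kappa * (fh theta) ^ 2) 0 (2 * PI) /\
    sign a = sign alpha /\
    a = sign alpha * sqrt (alpha ^ 2 + eta ^ 2 / (2 * PI)
              * RInt (fun theta => (f theta) ^ 2 - / kappa * (fh theta) ^ 2) 0 (2 * PI)).
Proof.
intros Hk Cf Mf Cfh Mfh Ru Rv Rg Hper Hsys Hind Hc Hge Hl HW.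
assert (HPI := PI_RGT_0).
destruct (oriented_flow kappa _ _ u v g h cstar Ru Rv Rg Hper Hsys Hind Hc Hge) as [e Fl].
assert (S := fl_st Fl).
destruct (von_Mises_onto S) as [Yv I].
assert (Hbd : forall s, u s 0 = alpha + eta * f s /\ g s 0 = beta + eta * fh s).
{ intros s; destruct Hsys as [_ [_ [_ [_ [E _]]]]]; destruct (E s) as [E1 [_ E3]]; auto. }
assert (Far : forall w L, far_uniform w L -> far_uniform (clamp w) L).
{ intros w L H eps Heps; destruct (H eps Heps) as [N HN]; exists (Rmin N 0).
  intros s Y Hs HY; rewrite clamp_below; [apply HN; auto |];
  [assert (X := Rmin_l N 0) | assert (X := Rmin_r N 0)]; lra. }
assert (Ha : far_uniform u a).
{ apply (weighted_far_uniform _ _ _ _ _ _ u a Hl HW); [apply HW |].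
  intros j k s Y.
  match goal with |- _ <= _ + ?x ^ 2 + ?y ^ 2 + ?z ^ 2 =>
    assert (P1 := pow2_ge_0 x); assert (P2 := pow2_ge_0 y); assert (P3 := pow2_ge_0 z) end.
  lra. }
assert (Hb : far_uniform g b).
{ apply (weighted_far_uniform _ _ _ _ _ _ g b Hl HW); [apply HW |].
  intros j k s Y.
  match goal with |- _ <= ?x ^ 2 + ?y ^ 2 + _ + ?z ^ 2 =>
    assert (P1 := pow2_ge_0 x); assert (P2 := pow2_ge_0 y); assert (P3 := pow2_ge_0 z) end.
  lra. }
destruct (flow_integrals Fl I a b (Far _ _ Ha) (Far _ _ Hb)) as [IG IK].
assert (Hcl : forall w s psi, psi <= 0 -> clamp w s (Yv s psi) = w s (Yv s psi)).
{ intros; apply clamp_below, (Yv_npos S I); auto. }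
assert (HvM : forall s Y, Y <= 0 -> von_Mises (clamp u) s Y = von_Mises u s Y).
{ intros s Y HY; apply RInt_ext; intros z; rewrite Rmin_right, Rmax_left by lra.
  intros Hz; apply clamp_below; lra. }
set (G := fun s psi => g s (Yv s psi)).
set (K := fun s psi => kappa * u s (Yv s psi) ^ 2 - g s (Yv s psi) ^ 2).
assert (EG : forall psi, psi <= 0 -> theta_integral G psi = 2 * PI * b).
{ intros psi Hp; rewrite <- (IG psi Hp); apply RInt_ext; intros s _.
  symmetry; apply Hcl, Hp. }
assert (EK : forall psi, psi <= 0 -> theta_integral K psi = 2 * PI * (kappa * a ^ 2 - b ^ 2)).
{ intros psi Hp; rewrite <- (IK psi Hp); apply RInt_ext; intros s _; unfold K.
  rewrite !Hcl by exact Hp; reflexivity. }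
assert (cG : constant_on_half_line (theta_integral G)).
{ intros p q Hp Hq; rewrite !EG by assumption; reflexivity. }
assert (cK : constant_on_half_line (theta_integral K)).
{ intros p q Hp Hq; rewrite !EK by assumption; reflexivity. }
assert (Y0 : forall s, Yv s 0 = 0) by (intros; apply (Yv_0 S I)).
assert (Eb : b = beta).
{ assert (E := EG 0 (Rle_refl 0)).
  assert (X := is_RInt_unique _ _ _ _ (RInt_affine_zero_mean fh beta eta Cfh Mfh)).
  assert (X' : theta_integral G 0 = 2 * PI * beta).
  { rewrite <- X; apply RInt_ext; intros s _; unfold G; rewrite Y0; apply Hbd. }
  apply (Rmult_eq_reg_l (2 * PI)); lra. }
assert (Een := is_RInt_unique _ _ _ _
  (boundary_energy kappa alpha beta eta f fh ltac:(lra) Cf Mf Cfh Mfh)).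
assert (E1 : 2 * PI * (kappa * a ^ 2 - b ^ 2)
  = RInt (fun s => kappa * (alpha + eta * f s) ^ 2 - (beta + eta * fh s) ^ 2) 0 (2 * PI)).
{ rewrite <- (EK 0 (Rle_refl 0)); apply RInt_ext; intros s _; unfold K.
  destruct (Hbd s) as [B1 B2]; rewrite Y0, B1, B2; reflexivity. }
set (J := RInt (fun s => f s ^ 2 - / kappa * fh s ^ 2) 0 (2 * PI)) in *.
assert (E2 : a ^ 2 = alpha ^ 2 + eta ^ 2 / (2 * PI) * J).
{ rewrite Een, Eb in E1.
  apply (Rmult_eq_reg_l (2 * PI * kappa)); [| assert (0 < 2 * PI * kappa) by nra; lra].
  replace (2 * PI * kappa * (alpha ^ 2 + eta ^ 2 / (2 * PI) * J))
    with (2 * PI * kappa * alpha ^ 2 + kappa * eta ^ 2 * J) by (field; lra).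
  lra. }
assert (Pa : 0 < a).
{ destruct (Ha (cstar / 2) ltac:(lra)) as [N HN].
  assert (H := HN 0 (Rmin N 0 - 1) ltac:(lra) ltac:(assert (X := Rmin_l N 0); lra)).
  assert (H' := Hge 0 (Rmin N 0 - 1) ltac:(assert (X := Rmin_r N 0); lra)).
  apply Rabs_def2 in H; lra. }
assert (Palpha : 0 < alpha).
{ assert (X := RInt_affine_zero_mean f alpha eta Cf Mf).
  assert (Y := is_RInt_const (V := R_NormedModule) 0 (2 * PI) cstar).
  assert (Hle : scal (2 * PI - 0) cstar <= 2 * PI * alpha).
  { apply (is_RInt_le (fun _ => cstar) (fun s => alpha + eta * f s) 0 (2 * PI) _ _
      ltac:(lra) Y X).
    intros s _; destruct (Hbd s) as [B1 _]; rewrite <- B1; apply Hge; lra. }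
  unfold scal in Hle; simpl in Hle; unfold mult in Hle; simpl in Hle; nra. }
exists Yv; split; [| split; [| split; [| split; [| split; [| split]]]]].
- destruct (von_Mises_inverse_of_right S I) as [V1 V2]; split.
  + intros s Y HY; rewrite <- HvM by exact HY; apply V1, HY.
  + intros s psi Hp; destruct (V2 s psi Hp) as [V3 V4].
    rewrite <- HvM by exact V3; auto.
- refine (conj _ (conj _ (conj (constant_zero_second_derivative _ cG)
    (conj (constant_zero_second_derivative _ cK) (conj cG cK))))).
  + intros psi Hp.
    apply (ex_RInt_ext (V := R_NormedModule) (fun s => clamp g s (Yv s psi))).
    * intros s _; apply Hcl, Hp.
    * apply (ex_RInt_fst (fun s z => clamp g s (Yv s z))); intros s.
      apply (continuity_pull S I), (fl_gc Fl).
  + intros psi Hp.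
    apply (ex_RInt_ext (V := R_NormedModule)
      (fun s => kappa * (clamp u s (Yv s psi) * clamp u s (Yv s psi))
                - clamp g s (Yv s psi) * clamp g s (Yv s psi))).
    * intros s _; rewrite !Hcl by exact Hp; eq_R; ring.
    * apply (ex_RInt_fst (fun s z => kappa * (clamp u s (Yv s z) * clamp u s (Yv s z))
                - clamp g s (Yv s z) * clamp g s (Yv s z))); intros s.
      assert (X1 := continuity_pull S I (clamp u) s psi (st_u S _ _)).
      assert (X2 := continuity_pull S I (clamp g) s psi (fl_gc Fl _ _)).
      apply continuity_2d_pt_minus; [| apply continuity_2d_pt_mult; exact X2].
      apply continuity_2d_pt_mult; [apply continuity_2d_pt_const |].
      apply continuity_2d_pt_mult; exact X1.
- exact Eb.
- rewrite <- E1; field; lra.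
- exact E2.
- rewrite !sign_eq_1 by assumption; reflexivity.
- rewrite sign_eq_1, <- E2, sqrt_pow2 by lra; ring.
Qed.

(** * Reversal of orientation *)

(** The factor [k] is there for the induction: each [theta]-derivative changes its sign. *)
Lemma ex_diff_n_reverse n k w :
  (forall s Y, Y < 0 -> ex_diff_n w n s Y) ->
  forall s Y, Y < 0 -> ex_diff_n (fun t z => k * w (- t) z) n s Y.
Proof.
revert k w; induction n as [| n IH]; intros k w H.
all: assert (Hc : forall s Y, Y < 0 -> continuity_2d_pt (fun t z => k * w (- t) z) s Y).
1, 3: intros s Y HY; apply continuity_2d_pt_mult; [apply continuity_2d_pt_const |];
  apply (continuity_2d_pt_comp w (fun t _ => - t) (fun _ z => z));
  [ destruct (H (- s) Y HY) as [X _]; exact X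
  | apply continuity_2d_pt_opp, continuity_2d_pt_id1 | apply continuity_2d_pt_id2 ].
- intros s Y HY; split; auto.
- assert (Dt : forall s Y, Y < 0 -> is_derive (fun t => k * w (- t) Y) s
                 (- k * Derive (fun t => w t Y) (- s))).
  { intros s Y HY; destruct (H (- s) Y HY) as [_ [X _]].
    auto_derive; [exact X | simpl; ring]. }
  assert (DY : forall s Y, Y < 0 -> is_derive (fun z => k * w (- s) z) Y
                 (k * Derive (fun z => w (- s) z) Y)).
  { intros s Y HY; destruct (H (- s) Y HY) as [_ [_ [X _]]].
    auto_derive; [exact X | simpl; ring]. }
  intros s Y HY; split; [apply Hc, HY | split; [| split; [| split]]].
  + eexists; apply Dt, HY.
  + eexists; apply DY, HY.
  + apply (ex_diff_n_ext_loc (fun t z => - k * Derive (fun x => w x z) (- t))).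
    * apply locally_2d_below; [| exact HY].
      intros t z Hz; symmetry; apply is_derive_unique, Dt, Hz.
    * apply (IH (- k) (fun t z => Derive (fun x => w x z) t)); [| exact HY].
      intros t z Hz; apply H, Hz.
  + apply (ex_diff_n_ext_loc (fun t z => k * Derive (fun x => w (- t) x) z)).
    * apply locally_2d_below; [| exact HY].
      intros t z Hz; symmetry; apply is_derive_unique, DY, Hz.
    * apply (IH k (fun t z => Derive (fun x => w t x) z)); [| exact HY].
      intros t z Hz; apply H, Hz.
Qed.

Lemma regular_scaled_reverse k w :
  regular w -> regular (fun s Y => k * w (- s) Y).
Proof.
intros [H Hc]; split; [intros s Y; apply ex_diff_n_reverse, H |].
intros [s Y] HY; simpl in HY.
assert (Hc' := Hc (- s, Y) HY).
apply (filterlim_comp _ _ _ (fun p : R * R => w (- fst p) (snd p)) (fun x => k * x)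
         _ (locally (w (- s) Y))).
2: { apply (continuous_mult (K := R_AbsRing) (fun _ => k) (fun x => x));
     [apply continuous_const | apply continuous_id]. }
intros P HP; destruct (Hc' P HP) as [d Hd].
exists d; intros [s' Y'] [Bs BY] HY'; apply (Hd (- s', Y')); [split |]; simpl in *; auto.
change (Rabs (- s' - - s) < d); change (Rabs (s' - s) < d) in Bs.
replace (- s' - - s) with (- (s' - s)) by ring; rewrite Rabs_Ropp; exact Bs.
Qed.

Lemma regular_ext w1 w2 : (forall s Y, w1 s Y = w2 s Y) -> regular w1 -> regular w2.
Proof.
intros E [H Hc]; split.
- intros s Y HY; apply (ex_diff_n_ext_loc w1); [apply locally_2d_forall; auto | apply H, HY].
- apply (continuous_on_ext _ (fun p => w1 (fst p) (snd p))); auto.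
Qed.

Lemma regular_reverse_odd r w : regular w -> regular (reverse_odd r w).
Proof.
destruct r; [intros H | exact (fun H => H)].
apply (regular_ext (fun s Y => -1 * w (- s) Y)).
- intros; unfold reverse_odd; ring.
- apply regular_scaled_reverse, H.
Qed.

Lemma regular_reverse_even r w : regular w -> regular (reverse_even r w).
Proof.
destruct r; [intros H | exact (fun H => H)].
apply (regular_ext (fun s Y => 1 * w (- s) Y)).
- intros; unfold reverse_even; ring.
- apply regular_scaled_reverse, H.
Qed.

Lemma periodic_opp (f : R -> R) : periodic f -> periodic (fun s => f (- s)).
Proof.
intros H s; rewrite <- (H (- (s + 2 * PI))); f_equal; ring.
Qed.

Lemma periodic_reverse_odd r w Y :
  periodic (fun s => w s Y) -> periodic (fun s => reverse_odd r w s Y).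
Proof.
intros H; destruct r; [| exact H].
intros s; unfold reverse_odd; f_equal; exact (periodic_opp _ H s).
Qed.

Lemma periodic_reverse_even r w Y :
  periodic (fun s => w s Y) -> periodic (fun s => reverse_even r w s Y).
Proof.
intros H; destruct r; [exact (periodic_opp _ H) | exact H].
Qed.

(** Every term of the momentum equation changes sign and every term of the other equations keeps
    it: the signs of [u] and [g] cancel against that of the [theta]-derivative, and they
    cancel in the quotients [v g / u] and [g_Y / u]. *)
Lemma MHD_Prandtl_reverse r kappa uw gw u v g h :
  regular u -> regular g ->
  MHD_Prandtl kappa uw gw u v g h ->
  MHD_Prandtl kappa (reverse_data r uw) (reverse_data r gw)
    (reverse_odd r u) (reverse_even r v) (reverse_odd r g) (reverse_even r h).
Proof.
intros [Ru _] [Rg _] H; destruct r; [| exact H].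
destruct H as [E1 [E2 [E3 [E4 [Ebd Elim]]]]].
assert (Dt : forall w, C2_interior w -> forall s Y, Y < 0 ->
          d_theta (reverse_odd true w) s Y = d_theta w (- s) Y).
{ intros w Hw s Y HY; destruct (Hw (- s) Y HY) as [_ [X _]].
  apply is_derive_unique; unfold reverse_odd; auto_derive; [exact X |].
  unfold d_theta; simpl; ring. }
assert (DY : forall w s Y, d_Y (reverse_odd true w) s Y = - d_Y w (- s) Y)
  by (intros; apply Derive_opp).
assert (Q : forall x y, - x / - y = x / y)
  by (intros; unfold Rdiv; rewrite Rinv_opp; ring).
repeat split.
- intros s Y HY; rewrite !Dt, !DY by auto.
  assert (X : d_Y (d_Y (reverse_odd true u)) s Y = - d_Y (d_Y u) (- s) Y).
  { transitivity (Derive (fun z => - d_Y u (- s) z) Y); [| apply Derive_opp].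
    apply Derive_ext; intros; apply DY. }
  rewrite X; unfold reverse_odd, reverse_even; rewrite <- (Ropp_0), <- (E1 (- s) Y HY); ring.
- intros s Y HY; rewrite Dt by auto; rewrite <- (E2 (- s) Y HY).
  assert (X1 : d_Y (fun t z => reverse_even true v t z * reverse_odd true g t z
                               / reverse_odd true u t z) s Y
               = d_Y (fun t z => v t z * g t z / u t z) (- s) Y).
  { apply Derive_ext; intros z; unfold reverse_odd, reverse_even.
    rewrite <- Ropp_mult_distr_r; apply Q. }
  assert (X2 : d_Y (fun t z => d_Y (reverse_odd true g) t z / reverse_odd true u t z) s Y
               = d_Y (fun t z => d_Y g t z / u t z) (- s) Y).
  { apply Derive_ext; intros z; rewrite DY; apply Q. }
  rewrite X1, X2; reflexivity.
- intros s Y HY; rewrite Dt by auto; apply E3, HY.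
- intros s Y HY; rewrite Dt by auto; apply E4, HY.
- unfold reverse_odd, reverse_data; f_equal; apply Ebd.
- unfold reverse_even; apply Ebd.
- unfold reverse_odd, reverse_data; f_equal; apply Ebd.
- apply (is_lim_ext (fun Y => - d_Y u (- theta) Y)); [intros; symmetry; apply DY |].
  evar_last; [apply is_lim_opp, Elim | simpl; f_equal; ring].
- apply (is_lim_ext (fun Y => - d_Y g (- theta) Y)); [intros; symmetry; apply DY |].
  evar_last; [apply is_lim_opp, Elim | simpl; f_equal; ring].
Qed.

Lemma induction_relation_reverse r u v g h :
  induction_relation u v g h ->
  induction_relation (reverse_odd r u) (reverse_even r v) (reverse_odd r g) (reverse_even r h).
Proof.
intros H; destruct r; [| exact H].
destruct H as [e He]; exists e; intros s Y HY.
unfold reverse_even at 1; rewrite (He (- s) Y HY); f_equal.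
assert (D : d_Y (reverse_odd true g) s Y = - d_Y g (- s) Y) by apply Derive_opp.
rewrite D; unfold reverse_odd, reverse_even, Rdiv; rewrite Rinv_opp; ring.
Qed.

Lemma MHD_Prandtl_data_ext kappa uw uw' gw gw' u v g h :
  (forall s, uw s = uw' s) -> (forall s, gw s = gw' s) ->
  MHD_Prandtl kappa uw gw u v g h -> MHD_Prandtl kappa uw' gw' u v g h.
Proof.
intros Eu Eg [E1 [E2 [E3 [E4 [Ebd Elim]]]]].
refine (conj E1 (conj E2 (conj E3 (conj E4 (conj _ Elim))))).
intros s; rewrite <- Eu, <- Eg; apply Ebd.
Qed.

Lemma continuous_reverse_data r f :
  smooth f -> forall x, continuous (reverse_data r f) x.
Proof.
intros H.
assert (Hc : forall x, continuous f x).
{ intros x; apply (ex_derive_continuous (V := R_NormedModule)); exact (H 1%nat x). }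
destruct r; [| exact Hc]; intros x.
apply (continuous_opp (V := R_NormedModule) (fun x => f (- x))).
apply (continuous_comp Ropp f); [| apply Hc].
apply (continuous_opp (V := R_NormedModule) (fun x => x)), continuous_id.
Qed.

Lemma zero_mean_reverse_data r f :
  smooth f -> periodic f -> zero_mean f -> zero_mean (reverse_data r f).
Proof.
intros Hs Hp Hm; destruct r; [| exact Hm].
assert (Hc := continuous_reverse_data false f Hs).
assert (Hex : forall p q, ex_RInt f p q)
  by (intros; apply (ex_RInt_continuous (V := R_CompleteNormedModule)); auto).
assert (I1 : is_RInt (fun s => opp (f (- s))) 0 (2 * PI) (RInt f 0 (- (2 * PI)))).
{ apply (is_RInt_comp_opp (V := R_NormedModule) f).
  rewrite Ropp_0; apply (RInt_correct (V := R_CompleteNormedModule)), Hex. }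
unfold zero_mean; rewrite (is_RInt_unique _ _ _ _ I1 : RInt (reverse_data true f) 0 (2 * PI) = _).
assert (I2 : RInt (fun s => scal 1 (f (1 * s + - (2 * PI)))) 0 (2 * PI)
             = RInt f (1 * 0 + - (2 * PI)) (1 * (2 * PI) + - (2 * PI)))
  by (apply (RInt_comp_lin (V := R_CompleteNormedModule)), Hex).
replace (1 * 0 + - (2 * PI)) with (- (2 * PI)) in I2 by ring.
replace (1 * (2 * PI) + - (2 * PI)) with 0 in I2 by ring.
rewrite <- (opp_RInt_swap (V := R_CompleteNormedModule)) by apply Hex.
rewrite <- I2, (RInt_ext _ f).
- rewrite Hm; unfold opp; simpl; ring.
- intros s _; unfold scal; simpl; unfold mult; simpl.
  rewrite Rmult_1_l, <- (Hp (1 * s + - (2 * PI))); f_equal; ring.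
Qed.

(** * Integrals and far field of the given solution *)

Theorem lemma2p1
  (kappa alpha0 beta0 eta cstar a b l C : R) (f0 fh0 : R -> R)
  (u0 v0 g0 h0 : R -> R -> R) (vinf hinf : R -> R) (r : bool) :
  0 < kappa -> alpha0 <> 0 -> 0 < eta ->
  smooth f0 -> periodic f0 -> zero_mean f0 ->
  smooth fh0 -> periodic fh0 -> zero_mean fh0 ->
  regular u0 -> regular v0 -> regular g0 -> regular h0 ->
  (forall Y, Y <= 0 ->
     periodic (fun theta => u0 theta Y) /\ periodic (fun theta => v0 theta Y) /\
     periodic (fun theta => g0 theta Y) /\ periodic (fun theta => h0 theta Y)) ->
  MHD_Prandtl kappa (fun theta => alpha0 + eta * f0 theta)
    (fun theta => beta0 + eta * fh0 theta) u0 v0 g0 h0 ->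
  induction_relation u0 v0 g0 h0 ->
  let u := reverse_odd r u0 in
  let v := reverse_even r v0 in
  let g := reverse_odd r g0 in
  let h := reverse_even r h0 in
  let alpha := reverse_const r alpha0 in
  let beta := reverse_const r beta0 in
  let f := reverse_data r f0 in
  let fh := reverse_data r fh0 in
  0 < cstar -> (forall theta Y, Y <= 0 -> cstar <= u theta Y) ->
  (forall theta, is_lim (fun Y => u theta Y) m_infty a) ->
  (forall theta, is_lim (fun Y => g theta Y) m_infty b) ->
  (forall theta, is_lim (fun Y => v theta Y) m_infty (vinf theta)) ->
  (forall theta, is_lim (fun Y => h theta Y) m_infty (hinf theta)) ->
  1 < l ->
  weighted_H2_bound l (C * eta ^ 2)
    (fun theta Y => u theta Y - a) (fun theta Y => v theta Y - vinf theta)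
    (fun theta Y => g theta Y - b) (fun theta Y => h theta Y - hinf theta) ->
  exists Yv : R -> R -> R,
    von_Mises_inverse u Yv /\
    (let G := fun theta psi => g theta (Yv theta psi) in
     let K := fun theta psi =>
       kappa * (u theta (Yv theta psi)) ^ 2 - (g theta (Yv theta psi)) ^ 2 in
     theta_integrable G /\ theta_integrable K /\
     zero_second_derivative (theta_integral G) /\
     zero_second_derivative (theta_integral K) /\
     constant_on_half_line (theta_integral G) /\
     constant_on_half_line (theta_integral K)) /\
    b = beta /\
    kappa * a ^ 2 - b ^ 2 =
      / (2 * PI) * RInt (fun theta => kappa * (alpha + eta * f theta) ^ 2
                                      - (beta + eta * fh theta) ^ 2) 0 (2 * PI) /\
    a ^ 2 = alpha ^ 2 + eta ^ 2 / (2 * PI)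
              * RInt (fun theta => (f theta) ^ 2 - / kappa * (fh theta) ^ 2) 0 (2 * PI) /\
    sign a = sign alpha /\
    a = sign alpha * sqrt (alpha ^ 2 + eta ^ 2 / (2 * PI)
              * RInt (fun theta => (f theta) ^ 2 - / kappa * (fh theta) ^ 2) 0 (2 * PI)).
Proof.
intros Hk _ _ Sf Pf Mf Sfh Pfh Mfh Ru Rv Rg _ Hper Hsys Hind u v g h alpha beta f fh
  Hc Hge _ _ _ _ Hl HW.
apply (oriented_case kappa alpha beta eta cstar a b l (C * eta ^ 2) f fh u v g h vinf hinf).
- exact Hk.
- apply continuous_reverse_data, Sf.
- apply zero_mean_reverse_data; assumption.
- apply continuous_reverse_data, Sfh.
- apply zero_mean_reverse_data; assumption.
- apply regular_reverse_odd, Ru.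
- apply regular_reverse_even, Rv.
- apply regular_reverse_odd, Rg.
- intros Y HY; destruct (Hper Y HY) as [P1 [P2 [P3 P4]]].
  refine (conj _ (conj _ (conj _ _))).
  + apply periodic_reverse_odd, P1.
  + apply periodic_reverse_even, P2.
  + apply periodic_reverse_odd, P3.
  + apply periodic_reverse_even, P4.
- apply (MHD_Prandtl_data_ext kappa (reverse_data r (fun s => alpha0 + eta * f0 s)) _
           (reverse_data r (fun s => beta0 + eta * fh0 s))).
  + intros s; unfold alpha, f; destruct r; simpl; ring.
  + intros s; unfold beta, fh; destruct r; simpl; ring.
  + apply MHD_Prandtl_reverse; assumption.
- apply induction_relation_reverse, Hind.
- exact Hc.
- exact Hge.
- lra.
- exact HW.
Qed.
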